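(* Let $(X,\mathcal X,m,T,w,\Gamma)$ be a Greg, $Q$ a metrizable compact convex space and $\Gamma\to\operatorname{Aff}(Q)$ a continuous homomorphism. Then there is a continuous affine bijection $\operatorname{Map}_w(X,Q)\cong\operatorname{Map}^{\mathrm{stat}}(X_+,Q)$, $\phi\leftrightarrow\psi$, given in one direction by $\psi(y)=\int_X\phi(x)\,d\mu_y(x)$ ($y\in X_+$), and in the other direction by the a.e. weak-* limit $$\phi(x)=\lim_{n\to\infty}w_{-n}(x)^{-1}.\psi(p_+(T^{-n}x))=\lim_{n\to\infty}w(T^{-1}x)w(T^{-2}x)\cdots w(T^{-n}x).\psi(p_+(T^{-n}x)).$$
   Context: A Greg is a tuple $(X,\mathcal X,m,T,w,\Gamma)$: standard probability space, invertible measure-preserving $T$, locally compact second countable group $\Gamma$, measurable $w:X\to\Gamma$; $w_n$ is the generated cocycle ($w_0=1$, $w_n=w\circ T^{n-1}\cdots w$ for $n>0$, $w_n(x)=w(T^nx)^{-1}\cdots w(T^{-1}x)^{-1}$ for $n<0$). Standing assumption: the $m$-complete $\sigma$-algebra generated by $\{w\circ T^k:k\in\mathbb Z\}$ is all of $\mathcal X$. $p_+:(X,m)\to(X_+,m_+)$ is the factor corresponding to the $m$-complete $\sigma$-algebra generated by $\{w\circ T^k:k\ge0\}$, and $m=\int_{X_+}\mu_y\,dm_+(y)$ the disintegration. A compact convex space is a non-empty compact convex set whose continuous affine functionals separate points; metrizable ones are affinely homeomorphic to closed convex subsets of $[0,1]^{\mathbb N}$. Integrals of $Q$-valued maps are barycenters: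 $\langle\lambda,\int\psi\,d\mu\rangle=\int\langle\lambda,\psi\rangle\,d\mu$ for continuous affine $\lambda$. $\operatorname{Map}(\cdot,Q)$ denotes measurable maps modulo null sets with the topology of convergence in measure. $\operatorname{Map}_w(X,Q)=\{\phi:\phi(Tx)=w(x).\phi(x)\text{ a.e.}\}$. $\psi\in\operatorname{Map}(X_+,Q)$ is stationary if $\psi(y)=\int_Xw(T^{-1}x).\psi(p_+(T^{-1}x))\,d\mu_y(x)$ for a.e. $y$; $\operatorname{Map}^{\mathrm{stat}}(X_+,Q)$ is the set of stationary maps. *)

(* Defs.v *)
From HB Require Import structures.
From mathcomp Require Import all_boot all_order all_algebra.
From mathcomp Require Import all_classical all_reals all_analysis.
Set Implicit Arguments. Unset Strict Implicit. Unset Printing Implicit Defensive.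
Import Order.TTheory GRing.Theory Num.Theory.
Local Open Scope classical_set_scope.
Local Open Scope ring_scope.

(* The ambient space [0,1]^N of a metrizable compact convex space, with the
   product (pointwise convergence) topology. *)
Notation V R := {ptws nat -> R^o}.

Definition cvx (R : realType) (t : R) (p q : V R) : V R :=
  fun k => t * p k + (1 - t) * q k.

(* Q is (an affine copy of) a metrizable compact convex space:
   a non-empty closed convex subset of [0,1]^N. *)
Definition metrizable_ccs (R : realType) (Q : set (V R)) : Prop :=
  [/\ Q !=set0,
      (forall q, Q q -> forall k, 0 <= q k <= 1),
      (forall t p q, 0 <= t <= 1 -> Q p -> Q q -> Q (cvx t p q)) &
      closed Q].

Definition lcsc_group (G : topologicalType) (mul : G -> G -> G) (inv : G -> G)
    (one : G) : Prop :=
  [/\ (forall a b c, mul a (mul b c) = mul (mul a b) c),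
      (forall a, mul one a = a /\ mul a one = a),
      (forall a, mul (inv a) a = one /\ mul a (inv a) = one),
      continuous (fun p : G * G => mul p.1 p.2) /\ continuous inv &
      hausdorff_space G /\
      (locally_compact [set: G] /\ @second_countable G)].

(* A continuous homomorphism G -> Aff(Q): each [act g] is an affine map of Q
   into itself, the action laws hold on Q, and (g, q) |-> act g q is
   (jointly) continuous on G x Q. *)
Definition cont_aff_action (R : realType) (G : topologicalType)
    (mul : G -> G -> G) (one : G) (Q : set (V R)) (act : G -> V R -> V R) :=
  [/\ (forall g q, Q q -> Q (act g q)),
      (forall g t p q, 0 <= t <= 1 -> Q p -> Q q ->
          act g (cvx t p q) = cvx t (act g p) (act g q)),
      (forall q, Q q -> act one q = q),
      (forall g h q, Q q -> act (mul g h) q = act g (act h q)) &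
      {within [set: G] `*` Q, continuous (fun p : G * V R => act p.1 p.2)}].

Definition inv_mp (R : realType) d (X : measurableType d)
    (m : probability X R) (T Tinv : X -> X) : Prop :=
  [/\ measurable_fun [set: X] T, measurable_fun [set: X] Tinv,
      cancel T Tinv, cancel Tinv T &
      forall A, measurable A -> m (T @^-1` A) = m A].

Definition borel_meas d (X : measurableType d) (G : topologicalType)
    (w : X -> G) : Prop := forall U, open U -> measurable (w @^-1` U).

(* T^k for k in Z, written as T^k (k >= 0) and T^{-k} = Tinv^k *)
Definition wsets d (X : measurableType d) (G : topologicalType)
    (T Tinv : X -> X) (w : X -> G) (future_only : bool) : set (set X) :=
  [set A | exists k : nat, exists U : set G, open U /\
     (A = (fun x => w (iter k T x)) @^-1` U \/
      (~~ future_only /\ A = (fun x => w (iter k Tinv x)) @^-1` U))].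

Definition subsigma_mod0 (R : realType) d (X : measurableType d)
    (m : probability X R) (S1 S2 : set (set X)) : Prop :=
  forall A, S1 A -> exists2 B, S2 B & m.-negligible ((A `\` B) `|` (B `\` A)).

(* Standing assumption: the m-completed sigma-algebra generated by the
   w o T^k (k in Z) is all of the sigma-algebra of X. *)
Definition generating (R : realType) d (X : measurableType d)
    (m : probability X R) (G : topologicalType) (T Tinv : X -> X) (w : X -> G)
    : Prop :=
  subsigma_mod0 m measurable <<s wsets T Tinv w false >>.

(* p_+ : X -> X_+ is (a model of) the factor corresponding to the m-completed
   sigma-algebra generated by the w o T^k, k >= 0. *)
Definition future_factor (R : realType) d (X : measurableType d)
    (m : probability X R) (G : topologicalType) (T Tinv : X -> X) (w : X -> G)
    d' (Xp : measurableType d') (pp : X -> Xp) : Prop :=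
  [/\ measurable_fun [set: X] pp,
      subsigma_mod0 m [set pp @^-1` B | B in measurable]
        <<s wsets T Tinv w true >> &
      subsigma_mod0 m <<s wsets T Tinv w true >>
        [set pp @^-1` B | B in measurable]].

Definition mplus (R : realType) d (X : measurableType d) (m : probability X R)
    d' (Xp : measurableType d') (pp : X -> Xp) := pushforward m pp.

Definition disintegration (R : realType) d (X : measurableType d)
    (m : probability X R) d' (Xp : measurableType d') (pp : X -> Xp)
    (mu : R.-pker Xp ~> X) : Prop :=
  forall A B, measurable A -> measurable B ->
    m (A `&` pp @^-1` B) = (\int[mplus m pp]_(y in B) mu y A)%E.

(* measurable Q-valued maps (representatives) *)
Definition Qmap (R : realType) d (X : measurableType d) (Q : set (V R))
    (f : X -> V R) : Prop :=
  (forall x, Q (f x)) /\ (forall k, measurable_fun [set: X] (fun x => f x k)).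

Definition vint (R : realType) d (X : measurableType d)
    (nu : {measure set X -> \bar R}) (f : X -> V R) : V R :=
  fun k => fine (\int[nu]_x (f x k)%:E)%E.

Definition Mapw (R : realType) d (X : measurableType d) (m : probability X R)
    (T : X -> X) (G : topologicalType) (w : X -> G) (Q : set (V R))
    (act : G -> V R -> V R) (phi : X -> V R) : Prop :=
  Qmap Q phi /\ {ae m, forall x, phi (T x) = act (w x) (phi x)}.

Definition stationary (R : realType) d (X : measurableType d)
    (m : probability X R) (Tinv : X -> X) (G : topologicalType) (w : X -> G)
    (act : G -> V R -> V R) d' (Xp : measurableType d') (pp : X -> Xp)
    (mu : R.-pker Xp ~> X) (psi : Xp -> V R) : Prop :=
  {ae mplus m pp, forall y,
     psi y = vint (mu y) (fun x => act (w (Tinv x)) (psi (pp (Tinv x))))}.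

Definition Fplus (R : realType) d (X : measurableType d)
    d' (Xp : measurableType d') (mu : R.-pker Xp ~> X) (phi : X -> V R)
    : Xp -> V R := fun y => vint (mu y) phi.

(* w(T^{-1}x) w(T^{-2}x) ... w(T^{-n}x) = w_{-n}(x)^{-1} *)
Fixpoint wback d (X : measurableType d) (G : topologicalType)
    (mul : G -> G -> G) (one : G) (Tinv : X -> X) (w : X -> G) (n : nat) (x : X)
    : G :=
  match n with
  | 0 => one
  | n'.+1 => mul (wback mul one Tinv w n' x) (w (iter n'.+1 Tinv x))
  end.

Definition back_term (R : realType) d (X : measurableType d)
    (G : topologicalType) (mul : G -> G -> G) (one : G) (Tinv : X -> X)
    (w : X -> G) (act : G -> V R -> V R) d' (Xp : measurableType d')
    (pp : X -> Xp) (psi : Xp -> V R) (x : X) (n : nat) : V R :=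
  act (wback mul one Tinv w n x) (psi (pp (iter n Tinv x))).

Definition dQ (R : realType) (p q : V R) : \bar R :=
  (\sum_(k <oo) (((2:R) ^- k) * `|p k - q k|)%:E)%E.

Definition cvg_in_measure (R : realType) d (X : measurableType d)
    (nu : set X -> \bar R) (f : nat -> X -> V R) (g : X -> V R) : Prop :=
  forall eps : R, 0 < eps ->
    (fun n => nu [set x | (eps%:E <= dQ (f n x) (g x))%E]) @ \oo --> 0%E.

(* Main.v *)
Require Import Defs.
From HB Require Import structures.
From mathcomp Require Import all_boot all_order all_algebra.
From mathcomp Require Import all_classical all_reals all_analysis measurable_realfun.
From mathcomp Require Import ring lra.
Import Order.TTheory GRing.Theory Num.Theory.
Import numFieldNormedType.Exports.
Set Implicit Arguments. Unset Strict Implicit. Unset Printing Implicit Defensive.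
Local Open Scope classical_set_scope.
Local Open Scope ring_scope.

(* Let [F_n] be the completed sigma-algebra generated by the [w o T^k], [k >= -n],
   and let [(L f)(x) = w(T^-1 x).f(T^-1 x)].  If [h = E[f | F_n]] then
   [L h = E[L f | F_(n+1)]]: for a constant group element this holds because a
   continuous affine map commutes with barycenters (the barycenters of [f] and [h]
   over a set of [F_n] coincide), and a general [F_n]-measurable group element is
   locally almost constant, uniformly on the compact [Q].  The backward products are
   [L^n (psi o p_+)].  Stationarity of [psi] says [E[L (psi o p_+) | F_0] = psi o p_+],
   so they form a bounded martingale, which converges almost everywhere; the limit
   [phi] is equivariant, and [E[phi | F_0] = psi o p_+].  If conversely
   [psi o p_+ = E[phi | F_0]] with [phi = L phi], the backward products are
   [E[phi | F_n]] and converge to [phi] because the [F_n] generate. *)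

(** * Barycenters *)

(** Conditional expectations enter only through their defining identity, equality of integrals over
    the sets of a sub-sigma-algebra. That barycenters stay in [Q] comes from a least-distance
    argument in finitely many coordinates; applied to the graph of a continuous affine functional,
    again a compact convex subset of [0,1]^N, it shows that the functional commutes with
    barycenters. The conditioning statement for affine actions is used twice: for the group, and for
    the real line multiplying a coordinate of the cube. The second use pulls measurable factors out
    of conditional expectations, which gives orthogonality of martingale increments, an L2 maximal
    inequality and convergence. The factor [pp] matches the future sigma-algebra only up to null
    sets, so the F_n must be saturated by null differences. Injectivity is contained in the limit
    formula: the backward products depend on [psi] alone, so their limit determines [phi].
    Continuity holds because averaging over fibres does not increase the integrated distance, while
    on a bounded [Q] convergence in measure amounts to convergence of that integral to 0. *)

Definition bounded_meas d (X : measurableType d) (R : realType) (f : X -> R) :=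
  measurable_fun [set: X] f /\ exists c, forall x, `|f x| <= c.

Section bounded_meas.
Context d (X : measurableType d) (R : realType).
Implicit Types f g : X -> R.

Lemma bounded_meas_cst (c : R) : bounded_meas (fun _ : X => c).
Proof. by split; [exact: measurable_cst | exists `|c|]. Qed.

Lemma bounded_measD f g :
  bounded_meas f -> bounded_meas g -> bounded_meas (fun x => f x + g x).
Proof.
move=> [mf [a fa]] [mg [b gb]]; split; first exact: measurable_funD.
by exists (a + b) => x; rewrite (le_trans (ler_normD _ _))// lerD.
Qed.

Lemma bounded_measM f g :
  bounded_meas f -> bounded_meas g -> bounded_meas (fun x => f x * g x).
Proof.
move=> [mf [a fa]] [mg [b gb]]; split; first exact: measurable_funM.
by exists (a * b) => x; rewrite normrM ler_pM.
Qed.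

Lemma bounded_measZ c f : bounded_meas f -> bounded_meas (fun x => c * f x).
Proof. by move=> bf; apply: bounded_measM => //; exact: bounded_meas_cst. Qed.

Lemma bounded_measB f g :
  bounded_meas f -> bounded_meas g -> bounded_meas (fun x => f x - g x).
Proof.
move=> [mf [a fa]] [mg [b gb]]; split; first exact: measurable_funB.
by exists (a + b) => x; rewrite (le_trans (ler_normB _ _))// lerD.
Qed.

Lemma bounded_meas_sum (F : nat -> X -> R) n :
  (forall k, bounded_meas (F k)) -> bounded_meas (fun x => \sum_(k < n) F k x).
Proof.
move=> bF; elim: n => [|n IH].
  by under eq_fun do rewrite big_ord0; exact: bounded_meas_cst.
by under eq_fun do rewrite big_ord_recr/=; exact: bounded_measD.
Qed.

Lemma bounded_meas01 f : measurable_fun [set: X] f ->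
  (forall x, 0 <= f x <= 1) -> bounded_meas f.
Proof.
move=> mf f01; split => //; exists 1 => x.
by have /andP[f0 f1] := f01 x; rewrite ger0_norm.
Qed.

Variable m : {measure set X -> \bar R}.
Implicit Types A : set X.

Lemma bounded_meas_integrable A f : measurable A -> (m A < +oo)%E ->
  bounded_meas f -> m.-integrable A (EFin \o f).
Proof.
move=> mA Aoo [mf [c fc]]; apply: measurable_bounded_integrable => //.
  exact: measurable_funTS.
by exists c; split; [rewrite num_real | move=> y cy x _; exact: le_trans (fc x) (ltW cy)].
Qed.

Lemma Rintegral_bsum A (F : nat -> X -> R) n : measurable A -> (m A < +oo)%E ->
  (forall k, bounded_meas (F k)) ->
  \int[m]_(x in A) (\sum_(k < n) F k x) = \sum_(k < n) \int[m]_(x in A) F k x.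
Proof.
move=> mA Aoo bF; elim: n => [|n IH].
  rewrite big_ord0; under eq_Rintegral do rewrite big_ord0.
  by rewrite Rintegral_cst// mul0r.
rewrite big_ord_recr/= -IH -RintegralD//; last 2 first.
- by apply: bounded_meas_integrable => //; exact: bounded_meas_sum.
- exact: bounded_meas_integrable.
by under eq_Rintegral do rewrite big_ord_recr.
Qed.

End bounded_meas.

(** * Cylinder neighbourhoods and compactness in [0,1]^N *)

Section pointwise_topology.
Context (R : realType).
Implicit Types (Q : set (V R)).

(** The cylinders around [b] generate a filter that converges to [b] in each coordinate, hence in
    the product topology; so every neighbourhood contains a cylinder. *)
Lemma nbhs_cylinder (b : V R) (U : set (V R)) : nbhs b U ->
  exists n eps, 0 < eps /\
    forall q : V R, (forall k, (k < n)%N -> `|q k - b k| < eps) -> U q.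
Proof.
pose B (i : nat * R) : set (V R) :=
  [set q | forall k, (k < i.1)%N -> `|q k - b k| < i.2].
pose D := [set i : nat * R | 0 < i.2].
have FF : Filter (filter_from D B).
  apply: filter_from_filter; first by exists (0%N, 1); exact: ltr01.
  move=> [n e] [n' e'] /= e0 e'0; exists (maxn n n', Num.min e e').
    by rewrite /D/= lt_min e0.
  move=> q /= Hq; split => k /= kn.
    by have := Hq k; rewrite leq_max kn lt_min => /(_ isT)/andP[].
  by have := Hq k; rewrite leq_max kn orbT lt_min => /(_ isT)/andP[].
have : filter_from D B --> b.
  apply/(@pointwise_cvgP nat R^o) => k; apply/cvgrPdist_lt => e e0.
  exists (k.+1, e) => //= q /= /(_ k (ltnSn k)); by rewrite distrC.
by move=> h /h [[n e] e0 BU]; exists n, e; split.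
Qed.

Lemma cvg_coordP (F : set_system (V R)) {FF : Filter F} (b : V R) :
  F --> b <-> forall k, (fun q : V R => q k : R) @ F --> (b k : R).
Proof. exact: (@pointwise_cvgP nat R^o). Qed.

Lemma ptws_coord_continuous k : continuous (fun q : V R => q k : R).
Proof. by move=> q; apply/(cvg_coordP (F := nbhs q) q).1. Qed.

Lemma compact_ccs Q : metrizable_ccs Q -> compact Q.
Proof.
move=> [_ Q01 _ clQ].
pose I : set (V R) := [set f | forall i, `[0, 1]%classic (f i)].
apply: (@subclosed_compact _ Q I) => //.
  apply: (@tychonoff nat (fun=> R^o) (fun=> `[(0:R), 1]%classic)) => i.
  exact: segment_compact.
Qed.

End pointwise_topology.

Lemma Qmap_bounded_meas (R : realType) d (X : measurableType d) (Q : set (V R))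
    (f : X -> V R) : metrizable_ccs Q -> Qmap Q f ->
  forall k, bounded_meas (fun x => f x k).
Proof.
by move=> [_ Q01 _ _] [fQ mf] k; apply: bounded_meas01 => // x; exact: Q01.
Qed.

Definition mean (R : realType) d (X : measurableType d)
    (m : {measure set X -> \bar R}) (A : set X) (f : X -> V R) : V R :=
  fun k => (fine (m A))^-1 * \int[m]_(x in A) f x k.

Section barycenter.
Context (R : realType) d (X : measurableType d) (m : {measure set X -> \bar R}).
Variables (A : set X).
Hypotheses (mA : measurable A) (Aoo : (m A < +oo)%E) (A0 : (0 < m A)%E).

Let c := fine (m A).
Let c0 : 0 < c. Proof. by rewrite fine_gt0// A0. Qed.

(** Linearity and monotonicity of the integral, in the only form in which the barycenter argument
    uses them. *)
Lemma mean_halfspace (f : X -> V R) (n : nat) (u : nat -> R) (C : R) :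
  (forall k, bounded_meas (fun x => f x k)) ->
  (forall x, A x -> \sum_(k < n) u k * f x k <= C) ->
  \sum_(k < n) u k * mean m A f k <= C.
Proof.
move=> bf fC.
have bu k : bounded_meas (fun x => u k * f x k) by exact: bounded_measZ.
have -> : \sum_(k < n) u k * mean m A f k =
    c^-1 * \int[m]_(x in A) (\sum_(k < n) u k * f x k).
  rewrite (@Rintegral_bsum _ _ _ m A (fun k x => u k * f x k))// mulr_sumr.
  apply: eq_bigr => k _.
  rewrite RintegralZl//; first by rewrite /mean -/c mulrCA.
  exact: bounded_meas_integrable.
rewrite mulrC ler_pdivrMr// -Rintegral_cst//; apply: le_Rintegral => //.
  apply: bounded_meas_integrable => //.
  exact: (@bounded_meas_sum _ _ _ (fun k x => u k * f x k)).
by apply: bounded_meas_integrable => //; exact: bounded_meas_cst.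
Qed.

(* If the barycenter [b] were at positive distance from [Q] in the first [n]
   coordinates, moving a near-minimizer [q] of that distance slightly towards
   each value of [f], and averaging over [A], would bring it closer to [b]. *)
Lemma mean_mem (Q : set (V R)) (f : X -> V R) :
  metrizable_ccs Q -> Qmap Q f -> Q (mean m A f).
Proof.
move=> HQ Qf; have [[q0 Qq0] Q01 Qcvx Qcl] := HQ.
have bf := Qmap_bounded_meas HQ Qf.
set b := mean m A f.
apply: contrapT => nQb.
have [n [e [e0 He]]] : exists n eps, 0 < eps /\
    forall q : V R, (forall k, (k < n)%N -> `|q k - b k| < eps) -> (~` Q) q.
  apply: nbhs_cylinder; apply: open_nbhs_nbhs; split => //.
  exact: closed_openC.
pose D (q : V R) : R := \sum_(k < n) (q k - b k) ^+ 2.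
have D0 q : 0 <= D q by apply: sumr_ge0 => k _; exact: sqr_ge0.
have De q : Q q -> e ^+ 2 <= D q.
  move=> Qq; rewrite leNgt; apply/negP => Dq; apply: (He q) => // k kn.
  rewrite -(ltr_pXn2r (n := 2))// ?nnegrE ?(ltW e0)// real_normK ?num_real//.
  apply: le_lt_trans Dq; rewrite /D (bigD1 (Ordinal kn))//= lerDl.
  by apply: sumr_ge0 => j _; exact: sqr_ge0.
pose S := D @` Q.
have hS : has_inf S.
  split; first by exists (D q0), q0.
  by exists 0 => _ [q _ <-].
(* In [N], the summand [n] bounds the squared distance of two points of [Q] in the first [n]
   coordinates, and 1 pays for the slack [t ^+ 2] in the choice of [q]. Averaging [key] gives
   [2 * D q <= t * N <= e ^+ 2], against [e ^+ 2 <= D q]. *)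
pose N : R := n.+1%:R.
have N0 : 0 < N by rewrite ltr0n.
pose t := Num.min 1 (e ^+ 2 / N).
have t0 : 0 < t by rewrite lt_min ltr01/= divr_gt0// exprn_gt0.
have t1 : t <= 1 by rewrite ge_min lexx.
have tN : t * N <= e ^+ 2 by rewrite -ler_pdivlMr// ge_min lexx orbT.
have [_ [q Qq <-] Dq] : exists2 r, S r & r < inf S + t ^+ 2.
  by apply: inf_adherent => //; exact: exprn_gt0.
have infS p : Q p -> inf S <= D p by move=> Qp; apply: ge_inf; [exact: hS.2|exists p].
have key p : Q p -> \sum_(k < n) (2 * (b k - q k)) * p k <=
    t * N + \sum_(k < n) (2 * (b k - q k)) * q k.
  move=> Qp; rewrite -lerBlDr -sumrB.
  have : D q - t ^+ 2 <= D (cvx t p q).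
    rewrite lerBlDr ltW//; apply: lt_le_trans Dq _.
    by rewrite lerD2r; apply: infS; apply: Qcvx => //; rewrite (ltW t0).
  have -> : D (cvx t p q) = D q
      - t * (\sum_(k < n) (2 * (b k - q k) * p k - 2 * (b k - q k) * q k))
      + t ^+ 2 * \sum_(k < n) (p k - q k) ^+ 2.
    rewrite /D !mulr_sumr -sumrB -big_split/=; apply: eq_bigr => k _.
    by rewrite /cvx; ring.
  have : \sum_(k < n) (p k - q k) ^+ 2 <= n%:R.
    rewrite -[n in n%:R]card_ord -sumr_const; apply: ler_sum => k _.
    have := Q01 _ Qp k; have := Q01 _ Qq k; nra.
  rewrite /N -natr1.
  set s1 := \sum_(k < n) (p k - q k) ^+ 2; set s2 := \sum_(k < n) _.
  move=> h1 h2; rewrite -(ler_pM2l t0); nra.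
have Db : 2 * D q <= t * N.
  have /(_ n (fun k => 2 * (b k - q k))) :=
    mean_halfspace (f := f)
      (C := t * N + \sum_(k < n) (2 * (b k - q k)) * q k) bf.
  move=> /(_ (fun x _ => key _ (Qf.1 x))); rewrite -/b -lerBlDr -sumrB.
  apply: le_trans; rewrite le_eqVlt; apply/orP; left; apply/eqP.
  by rewrite /D mulr_sumr; apply: eq_bigr => k _; ring.
have := De _ Qq; have := exprn_gt0 2 e0; lra.
Qed.

End barycenter.

(** A new coordinate 0 keeps the graph of a functional inside the same ambient space of
    sequences. *)
Definition pcons (R : realType) (r : R) (q : V R) : V R :=
  fun k => if k is k'.+1 then q k' else r.

Definition ptail (R : realType) (q : V R) : V R := fun k => q k.+1.

Definition affine_on (R : realType) (Q : set (V R)) (a : V R -> R) :=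
  forall t p q, 0 <= t <= 1 -> Q p -> Q q ->
    a (cvx t p q) = t * a p + (1 - t) * a q.

Section affine_functional.
Context (R : realType).
Variables (Q : set (V R)) (HQ : metrizable_ccs Q) (a : V R -> R).
Hypotheses (a_cont : {within Q, continuous a}) (a_aff : affine_on Q a)
  (a01 : forall q, Q q -> 0 <= a q <= 1).

Let graph : set (V R) := [set p | Q (ptail p) /\ p 0%N = a (ptail p)].

Lemma ptail_continuous : continuous (@ptail R).
Proof.
move=> p; have FF := fmap_filter (@ptail R) (nbhs_filter p).
apply: (cvg_coordP (FF := FF) (ptail p)).2 => k.
exact: (@ptws_coord_continuous R k.+1 p).
Qed.

(** The bounds on [a] keep coordinate 0 in [0,1]; affinity makes the graph convex, and continuity on
    [Q] makes it closed. *)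
Lemma graph_ccs : metrizable_ccs graph.
Proof.
have [[q0 Qq0] Q01 Qcvx Qcl] := HQ; split.
- by exists (pcons (a q0) q0).
- by move=> q [Qt q0E] [|k]; [rewrite q0E; exact: a01 | exact: (Q01 _ Qt k)].
- move=> t p q t01 [Qp p0] [Qq q0']; split; first exact: (Qcvx t _ _ t01 Qp Qq).
  by rewrite /cvx p0 q0' -a_aff.
- move=> p clp.
  have Qp : Q (ptail p).
    apply: Qcl => U /ptail_continuous pU.
    by have [p' [[Qp' _] Up']] := clp _ pU; exists (ptail p').
  split => //; apply/eqP; rewrite -subr_eq0 -normr_le0.
  apply/ler_addgt0Pl => e e0; rewrite addr0.
  have e20 : 0 < e / 2 by rewrite divr_gt0.
  have pU : nbhs (ptail p) [set q | Q q -> `|a (ptail p) - a q| < e / 2].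
    by have /subspace_continuousP/(_ _ Qp)/cvgrPdist_lt/(_ _ e20) := a_cont.
  have {}pU : nbhs p [set p' | Q (ptail p') -> `|a (ptail p) - a (ptail p')| < e / 2].
    exact: (ptail_continuous pU).
  have pV : nbhs p [set p' : V R | `|p 0%N - p' 0%N| < e / 2].
    by have /cvgrPdist_lt/(_ _ e20) := @ptws_coord_continuous R 0%N p.
  have [p' [[Qp' p'0] [/= /(_ Qp') H1]]] :=
    clp _ (@filterI _ _ (nbhs_filter p) _ _ pU pV).
  rewrite p'0 => H2.
  have -> : p 0%N - a (ptail p) =
      (p 0%N - a (ptail p')) - (a (ptail p) - a (ptail p')) by ring.
  apply: le_trans (ler_normB _ _) _; lra.
Qed.

(* The barycenter of [x |-> (a (f x), f x)] lies on the graph of [a]. *)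
Lemma affine_mean d (X : measurableType d) (m : {measure set X -> \bar R})
    (A : set X) (f : X -> V R) :
  measurable A -> (m A < +oo)%E -> (0 < m A)%E -> Qmap Q f ->
  measurable_fun [set: X] (a \o f) ->
  a (mean m A f) = (fine (m A))^-1 * \int[m]_(x in A) a (f x).
Proof.
move=> mA Aoo A0 [fQ mf] maf.
pose f' x := pcons (a (f x)) (f x).
have Qf' : Qmap graph f'.
  split=> [x|[|k]]; first by split=> //; exact: fQ.
  - exact: maf.
  - exact: (mf k).
by have [_ <-] := mean_mem mA Aoo A0 graph_ccs Qf'.
Qed.

End affine_functional.

(** * Functions on G x Q: measurability and uniformity in [Q] *)

Lemma second_countable_seq (G : topologicalType) : @second_countable G ->
  exists b : nat -> set G, (forall i, open (b i)) /\
    forall g U, nbhs g U -> exists2 i, b i g & b i `<=` U.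
Proof.
move=> [B /countable_injP[f finj] [Bo Bb]].
(* Indices that number no basic set receive the empty set. *)
pose b i := xget set0 [set U | B U /\ f U = i].
exists b; split => [i|g U /Bb[W [BW Wg] WU]].
  by rewrite /b; case: xgetP => [W _ [/Bo]//|_]; exact: open0.
exists (f W); rewrite /b; case: xgetP => [W' _ [BW' /finj]|/(_ W)[]//];
  by rewrite !inE => ->.
Qed.

Section measurable_composition.
Context (R : realType) (G : topologicalType).
Variables (Q : set (V R)) (F : G * V R -> R).
Hypothesis G2 : @second_countable G.
Hypothesis F_cont : {within [set: G] `*` Q, continuous F}.

Lemma nbhs_box (g : G) (q : V R) (P : set R) : Q q -> nbhs (F (g, q)) P ->
  exists (U : set G) (W : set (V R)), [/\ nbhs g U, nbhs q W &
    forall g' q', U g' -> W q' -> Q q' -> P (F (g', q'))].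
Proof.
move=> Qq PF.
have /subspace_continuousP/(_ (g, q) (conj I Qq) _ PF) := F_cont.
rewrite nbhs_simpl/= => -[[U W] /= [gU qW] UW].
exists U, W; split=> // g' q' Ug' Wq' Qq'.
exact: (UW (g', q')).
Qed.

(** Rational endpoints in finitely many coordinates: the index type is countable, so unions over it
    preserve measurability. *)
Let cyl (s : seq (rat * rat)) : set (V R) := [set q |
  forall k, (k < size s)%N ->
    ratr (nth (0, 0)%R s k).1 < q k < ratr (nth (0, 0)%R s k).2].

Lemma nbhs_rat_cylinder (q : V R) (W : set (V R)) : nbhs q W ->
  exists2 s, cyl s q & cyl s `<=` W.
Proof.
move=> /nbhs_cylinder[n [e [e0 eW]]].
have /choice[r Hr] : forall k, exists r : rat * rat,
    q k - e < ratr r.1 < q k /\ q k < ratr r.2 < q k + e.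
  move=> k.
  have /rat_in_itvoo[r1] : q k - e < q k by rewrite gtrBl.
  have /rat_in_itvoo[r2] : q k < q k + e by rewrite ltrDl.
  by rewrite !in_itv/= => h2 h1; exists (r1, r2).
exists (mkseq r n) => [k|q' /= Hq'].
  rewrite size_mkseq => kn; rewrite nth_mkseq//.
  by have [/andP[_ ->] /andP[-> _]] := Hr k.
apply: eW => k kn; rewrite ltr_distl.
have := Hq' k; rewrite size_mkseq => /(_ kn); rewrite nth_mkseq//.
by have [/andP[h1 h2] /andP[h3 h4]] := Hr k => /andP[h5 h6];
  rewrite (lt_trans h1)// (lt_trans h6).
Qed.

(** The preimage of an open interval is a countable union of preimages of boxes, a basic open set of
    [G] times a rational cylinder. [F] is controlled only on the part of a box above [Q], which
    suffices because [f] takes its values there. *)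
Lemma measurable_fun_box d (Y : measurableType d) (g : Y -> G) (f : Y -> V R) :
  borel_meas g -> Qmap Q f -> measurable_fun [set: Y] (fun y => F (g y, f y)).
Proof.
move=> mg [fQ mf]; have [B [Bo Bb]] := second_countable_seq G2.
apply: (measurability _ (RGenOpens.measurableE R)) => _ [_ [a [b ->] <-]].
rewrite setTI.
set P := `]a, b[%classic.
have oP : open P by exact: interval_open.
pose good i s :=
  forall g' q', B i g' -> cyl s q' -> Q q' -> P (F (g', q')).
have -> : (fun y => F (g y, f y)) @^-1` P =
    \bigcup_(s in [set: seq (rat * rat)]) \bigcup_(i in [set i | good i s])
      (g @^-1` (B i) `&` f @^-1` (cyl s)).
  apply/seteqP; split => [y /= Py|y [s _ [i gi] [gU fs]]]; last first.
    exact: (gi _ _ gU fs (fQ y)).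
  have [U [W [gU fW UW]]] := nbhs_box (fQ y) (open_nbhs_nbhs (conj oP Py)).
  have [s fs sW] := nbhs_rat_cylinder fW.
  have [i Big BiU] := Bb _ _ gU.
  exists s => //; exists i => // g' q' /BiU Ug' /sW Wq' Qq'.
  exact: UW.
apply: countable_bigcupT_measurable; first exact: countableP.
move=> s; apply: bigcup_measurable => i _; apply: measurableI; first exact/mg/Bo.
have -> : f @^-1` (cyl s) = \bigcap_(k in [set k | (k < size s)%N])
    (fun y => f y k) @^-1` `]ratr (nth (0, 0)%R s k).1, ratr (nth (0, 0)%R s k).2[%classic.
  by apply/seteqP; split => y /= H k kn; have /= := H k kn; rewrite /= in_itv.
apply: bigcap_measurableType => k _; rewrite -[X in measurable X]setTI.
exact: mf.
Qed.

(** Tube lemma: by compactness of [Q], the neighbourhoods of [g] obtained near each [q] can be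
    replaced by a common one. *)
Lemma uniform_in_compact (g : G) (e : R) : metrizable_ccs Q -> 0 < e ->
  \forall g' \near g, forall q, Q q -> `|F (g', q) - F (g, q)| < e.
Proof.
move=> /compact_ccs/compact_near_coveringP cQ e0.
have e20 : 0 < e / 2 by rewrite divr_gt0.
have : \forall g' \near nbhs g,
    Q `<=` (fun q => Q q -> `|F (g', q) - F (g, q)| < e); last first.
  by apply: filterS => g' H q Qq; exact: H.
apply: cQ => q Qq.
have [U [W [gU qW UW]]] := nbhs_box Qq (nbhsx_ballx (F (g, q)) _ e20).
exists (W, U) => //= -[q' g'] /= [Wq' Ug'] Qq'.
have := UW _ _ Ug' Wq' Qq'; have := UW _ _ (nbhs_singleton gU) Wq' Qq'.
rewrite /ball/= => h1 h2.
have -> : F (g', q') - F (g, q') =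
  (F (g, q) - F (g, q')) - (F (g, q) - F (g', q')) by ring.
apply: le_lt_trans (ler_normB _ _) _; lra.
Qed.

End measurable_composition.

(** * Conditioning and affine actions *)

(** For bounded functions this says that [f] and [h] have the same conditional expectation given
    [F]; when [h] is itself [F]-measurable, it says that [h] is a version of E[f | F]. *)
Definition same_integrals (R : realType) d (X : measurableType d)
    (m : {measure set X -> \bar R}) (F : set (set X)) (f h : X -> R) :=
  forall A, F A -> \int[m]_(x in A) f x = \int[m]_(x in A) h x.

Section affine_conditioning.
Context (R : realType) d (X : measurableType d) (m : probability X R).
Variable F : set (set X).
Hypotheses (F_alg : sigma_algebra setT F) (F_meas : F `<=` measurable).
Variables (Q : set (V R)) (HQ : metrizable_ccs Q).

Let fin A : measurable A -> (m A < +oo)%E.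
Proof. by move=> mA; rewrite ltey_eq fin_num_measure. Qed.

Lemma sub_sigmaP (A : set X) :
  @measurable _ (g_sigma_algebraType F) A <-> F A.
Proof. by rewrite /measurable/= sigma_algebra_id. Qed.

(** The average of [a \o f] over [A] is the value of [a] at the mean of [f], and [f] and [h] have
    the same mean. Null sets are treated apart because there is nothing to average over. *)
Lemma same_integrals_affine (a : V R -> R) (f h : X -> V R) :
  {within Q, continuous a} -> affine_on Q a -> (forall q, Q q -> 0 <= a q <= 1) ->
  Qmap Q f -> Qmap Q h ->
  measurable_fun [set: X] (a \o f) -> measurable_fun [set: X] (a \o h) ->
  (forall k, same_integrals m F (fun x => f x k) (fun x => h x k)) ->
  same_integrals m F (a \o f) (a \o h).
Proof.
move=> ac aa a01 Qf Qh maf mah fh A FA; have mA := F_meas FA.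
have [A0|A0] := eqVneq (m A) 0%E.
  by rewrite /Rintegral !null_set_integral//;
    apply/measurable_EFinP; exact: measurable_funTS.
have Ap : (0 < m A)%E by rewrite lt0e A0 measure_ge0.
have c0 : (fine (m A))^-1 != 0.
  by rewrite invr_eq0 gt_eqF// fine_gt0// Ap fin.
apply: (mulfI c0).
rewrite -(affine_mean HQ ac aa a01 mA (fin mA) Ap Qf maf).
rewrite -(affine_mean HQ ac aa a01 mA (fin mA) Ap Qh mah).
by congr a; apply/funext => k; rewrite /mean fh.
Qed.

Context (G : topologicalType).
Variables (a : G * V R -> R) (g : X -> G).
Hypothesis G2 : @second_countable G.
Hypothesis a_cont : {within [set: G] `*` Q, continuous a}.
Hypothesis gF : forall U, open U -> F (g @^-1` U).
Hypothesis a_aff : forall x, affine_on Q (fun q => a (g x, q)).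
Hypothesis a01 : forall x q, Q q -> 0 <= a (g x, q) <= 1.

Lemma slice_continuous g0 : {within Q, continuous (fun q => a (g0, q))}.
Proof.
apply/subspace_continuousP => q Qq P /= /(nbhs_box a_cont Qq)[U [W [gU qW UW]]].
by apply: filterS qW => q' Wq' Qq'; apply: UW => //; exact: nbhs_singleton.
Qed.

Let g_meas : borel_meas g. Proof. by move=> U /gF /F_meas. Qed.

Let a_bounded (f : X -> V R) : Qmap Q f -> bounded_meas (fun x => a (g x, f x)).
Proof.
move=> Qf; apply: bounded_meas01 => [|x]; last by apply: a01; exact: Qf.1.
exact: (measurable_fun_box G2 a_cont).
Qed.

Let slice_bounded x0 (f : X -> V R) : Qmap Q f -> bounded_meas (fun x => a (g x0, f x)).
Proof.
move=> Qf; apply: bounded_meas01 => [|x]; last by apply: a01; exact: Qf.1.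
apply: (@measurable_fun_box _ _ _ _ G2 a_cont _ _ (fun=> g x0)) => // U oU.
by have [?|?] := pselect (U (g x0));
  [rewrite (_ : _ @^-1` _ = setT)|rewrite (_ : _ @^-1` _ = set0)] => //;
  apply/seteqP; split.
Qed.

(** The element [g x] is frozen at [g x0] for [f] and released again for [h]; each exchange costs
    [e]. *)
Let piece (f h : X -> V R) (B : set X) (x0 : X) (e : R) : 0 < e ->
  Qmap Q f -> Qmap Q h ->
  (forall k, same_integrals m F (fun x => f x k) (fun x => h x k)) ->
  F B -> (forall x, B x -> forall q, Q q -> `|a (g x, q) - a (g x0, q)| < e) ->
  \int[m]_(x in B) a (g x, f x) <= \int[m]_(x in B) (a (g x, h x) + (e + e)).
Proof.
move=> e0 Qf Qh fh FB Be; have mB := F_meas FB; have Boo := fin mB.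
have int := bounded_meas_integrable mB Boo.
have be : bounded_meas (fun _ : X => e) by exact: bounded_meas_cst.
have bee : bounded_meas (fun _ : X => e + e) by exact: bounded_meas_cst.
apply: (@le_trans _ _ (\int[m]_(x in B) (a (g x0, f x) + e))).
  apply: le_Rintegral => //.
  - exact/int/a_bounded.
  - by apply/int/bounded_measD => //; exact: slice_bounded.
  - by move=> x Bx; have := Be x Bx _ (Qf.1 x); rewrite ltr_distl; lra.
rewrite RintegralD//; [|exact/int/slice_bounded|exact/int].
have -> : \int[m]_(x in B) a (g x0, f x) = \int[m]_(x in B) a (g x0, h x).
  exact: (same_integrals_affine (@slice_continuous (g x0)) (a_aff x0) (a01 x0)
    Qf Qh (slice_bounded x0 Qf).1 (slice_bounded x0 Qh).1 fh FB).
rewrite -RintegralD//; [|exact/int/slice_bounded|exact/int].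
apply: le_Rintegral => //.
- by apply/int/bounded_measD => //; exact: slice_bounded.
- by apply/int/bounded_measD => //; exact: a_bounded.
- by move=> x Bx; have := Be x Bx _ (Qh.1 x); rewrite ltr_distl; lra.
Qed.

(** Countably many sets of [F] on which [g] is almost constant, uniformly over [Q], cover the space.
    Made disjoint, they cut [A] into pieces compared one by one; the total error is [e] times the
    mass of [A], at most [e]. One inequality is enough, by symmetry in [f] and [h]. *)
Let le_same_integrals (f h : X -> V R) : Qmap Q f -> Qmap Q h ->
  (forall k, same_integrals m F (fun x => f x k) (fun x => h x k)) ->
  forall A, F A ->
  \int[m]_(x in A) a (g x, f x) <= \int[m]_(x in A) a (g x, h x).
Proof.
move=> Qf Qh fh A FA; have mA := F_meas FA.
have int B f0 : measurable B -> bounded_meas f0 -> m.-integrable B (EFin \o f0).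
  by move=> mB; exact: bounded_meas_integrable (fin mB).
apply/ler_addgt0Pl => e e0.
pose e' := e / 2; have e'0 : 0 < e' by rewrite divr_gt0.
have [b [bo bb]] := second_countable_seq G2.
(* The reference element is a value [g x0], since [a] is assumed affine and bounded only along
   values of [g]. *)
pose good i := exists x0, forall g', b i g' ->
  forall q, Q q -> `|a (g', q) - a (g x0, q)| < e'.
pose E i : set X := if pselect (good i) then g @^-1` (b i) else set0.
pose Y := g_sigma_algebraType F.
have mE i : @measurable _ Y (E i).
  by rewrite /E; case: pselect => //= gi; exact/sub_sigmaP/gF.
pose B i := A `&` seqDU E i.
have FB i : F (B i).
  apply/sub_sigmaP/measurableI; first exact/sub_sigmaP.
  exact: (@seqDU_measurable _ Y).
have AE : A = \bigcup_i B i.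
  rewrite -setI_bigcupr -seqDU_bigcup_eq; apply/esym/setIidPl => x _.
  have := uniform_in_compact a_cont (g x) HQ e'0.
  move=> /bb[i big bi]; exists i => //; rewrite /E; case: pselect => // -[].
  by exists x => g' /bi.
have tB : trivIset setT B.
  exact/trivIset_setIl/trivIset_seqDU.
have ba : bounded_meas (fun x => a (g x, h x) + (e' + e')).
  by apply: bounded_measD; [exact: a_bounded|exact: bounded_meas_cst].
suff : \int[m]_(x in A) a (g x, f x) <= \int[m]_(x in A) (a (g x, h x) + (e' + e')).
  move=> /le_trans; apply.
  rewrite RintegralD//; [|by apply: int => //; exact: a_bounded|
    by apply: int => //; exact: bounded_meas_cst].
  rewrite Rintegral_cst// addrC lerD2r.
  have : fine (m A) <= 1 by rewrite -lee_fin fineK ?fin_num_measure// probability_le1.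
  have : 0 <= fine (m A) by exact: fine_ge0.
  by rewrite /e'; nra.
have a0 x : 0 <= a (g x, f x) by have /andP[] := a01 x (Qf.1 x).
have a0' x : 0 <= a (g x, h x) + (e' + e').
  by have /andP[] := a01 x (Qh.1 x); lra.
apply: fine_le.
- by apply/integrable_fin_num => //; apply: int => //; exact: a_bounded.
- by apply/integrable_fin_num => //; exact: int.
have mB i : measurable (B i) by exact/F_meas/FB.
rewrite AE !ge0_integral_bigcup//; last 4 first.
- apply/measurable_EFinP/measurable_funTS; exact: ba.1.
- by move=> x _; rewrite lee_fin.
- apply/measurable_EFinP/measurable_funTS; exact: (a_bounded Qf).1.
- by move=> x _; rewrite lee_fin.
apply: lee_nneseries => [i _ _|i _].
  by apply: integral_ge0 => x _; rewrite lee_fin.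
rewrite -[leLHS]fineK; last by apply/integrable_fin_num => //; apply: int => //; exact: a_bounded.
rewrite -[leRHS]fineK; last by apply/integrable_fin_num => //; exact: int.
rewrite lee_fin.
have [[x0 gx0]|ngood] := pselect (good i).
  have Be x : B i x -> forall q, Q q -> `|a (g x, q) - a (g x0, q)| < e'.
    move=> [_ Ex]; have : E i x by exact: (subset_seqDU Ex).
    by rewrite /E; case: pselect => //= gi bgx q Qq; exact: gx0.
  exact: (@piece f h (B i) x0 e').
have -> : B i = set0.
  apply/seteqP; split => // x [_ Ex]; have : E i x by exact: (subset_seqDU Ex).
  by rewrite /E; case: pselect.
by rewrite !integral_set0.
Qed.

Lemma same_integrals_act (f h : X -> V R) : Qmap Q f -> Qmap Q h ->
  (forall k, same_integrals m F (fun x => f x k) (fun x => h x k)) ->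
  same_integrals m F (fun x => a (g x, f x)) (fun x => a (g x, h x)).
Proof.
move=> Qf Qh fh A FA; apply/eqP; rewrite eq_le !le_same_integrals// => k B FB.
exact/esym/fh.
Qed.

End affine_conditioning.

(** * Bounded martingales *)

(** Lets the real line take the place of the group in [same_integrals_act]. *)
Lemma second_countable_real (R : realType) : @second_countable R.
Proof.
pose I (r : rat * rat) : set R := `]ratr r.1, ratr r.2[%classic.
exists (range I); first exact: (card_le_trans (card_image_le _ _) (countableP _)).
split => [_ [r _ <-]|x U /nbhs_ballP[e /= e0 eU]]; first exact: interval_open.
have /rat_in_itvoo[r1] : x - e < x by rewrite gtrBl.
have /rat_in_itvoo[r2] : x < x + e by rewrite ltrDl.
rewrite !in_itv/= => /andP[h2 h3] /andP[h0 h1].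
exists (I (r1, r2)); first by split; [exists (r1, r2)|rewrite /I/= in_itv/= h1 h2].
rewrite /I => y /=; rewrite in_itv/= => /andP[h4 h5]; apply: eU.
by rewrite /ball/= ltr_distlC (lt_trans h0)//= (lt_trans h5).
Qed.

Definition cube (R : realType) : set (V R) := [set q | forall k, 0 <= q k <= 1].

Lemma cube_ccs (R : realType) : metrizable_ccs (@cube R).
Proof.
split => //.
- by exists (fun=> 0) => k; rewrite lexx ler01.
- move=> t p q t01 Qp Qq k; rewrite /cvx.
  by have := Qp k; have := Qq k; move: t01 => /andP[? ?] /andP[? ?] /andP[? ?]; nra.
- have -> : @cube R = \bigcap_k (fun q : V R => q k : R) @^-1` `[0, 1]%classic.
    by apply/seteqP; split => q /= H k; [move=> _|]; have := H k;
      rewrite /= in_itv/=; last exact.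
  apply: closed_bigI => k _; apply: preimage_closed; last exact: interval_closed.
  by move=> q _; exact: ptws_coord_continuous.
Qed.

(* [same_integrals_act] for [u] acting by multiplication. *)
Lemma same_integralsM (R : realType) d (X : measurableType d)
    (m : probability X R) (F : set (set X)) (u f h : X -> R) :
  sigma_algebra setT F -> F `<=` measurable ->
  measurable_fun [set: g_sigma_algebraType F] (u : g_sigma_algebraType F -> R) ->
  measurable_fun [set: X] f -> measurable_fun [set: X] h ->
  (forall x, 0 <= u x <= 1) -> (forall x, 0 <= f x <= 1) ->
  (forall x, 0 <= h x <= 1) -> same_integrals m F f h ->
  same_integrals m F (fun x => u x * f x) (fun x => u x * h x).
Proof.
move=> Fa Fm mu mf mh u01 f01 h01 fh.
pose a (p : R * V R) : R := p.1 * (p.2 0%N : R).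
have ca : {within [set: R] `*` (@cube R), continuous a}.
  apply: continuous_subspaceT => p.
  have c1 : {for p, continuous (fst : R * V R -> R)} by exact: cvg_fst.
  have c2 : {for p, continuous (fun p : R * V R => p.2 0%N : R)}.
    refine (@continuous_comp (R * V R)%type _ _ snd
      (fun q : V R => q 0%N : R) p _ _); first exact: cvg_snd.
    exact: ptws_coord_continuous.
  exact: (continuousM c1 c2).
apply: (@same_integrals_act _ _ _ m F Fa Fm _ (@cube_ccs R) _ a u
  (@second_countable_real R) ca _ _ _ (fun x _ => f x) (fun x _ => h x)) => //.
- move=> U /open_measurable mU; apply/sub_sigmaP => //.
  by have := mu measurableT _ mU; rewrite setTI.
- by move=> x t p q _ _ _; rewrite /a/= /cvx; ring.
- move=> x q /(_ 0%N)/andP[q0 q1]; rewrite /a/=.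
  by have /andP[? ?] := u01 x; rewrite mulr_ge0//= mulr_ile1.
- by split=> [x k|k]; [exact: f01|exact: mf].
- by split=> [x k|k]; [exact: h01|exact: mh].
Qed.

Section martingale.
Context (R : realType) d (X : measurableType d) (m : probability X R).
Variables (F : nat -> set (set X)) (M : nat -> X -> R).
Hypotheses (F_alg : forall n, sigma_algebra setT (F n))
  (F_meas : forall n, F n `<=` measurable)
  (F_mono : forall n, F n `<=` F n.+1)
  (M01 : forall n x, 0 <= M n x <= 1)
  (M_adapted : forall n, measurable_fun [set: g_sigma_algebraType (F n)]
     (M n : g_sigma_algebraType (F n) -> R))
  (M_mart : forall n, same_integrals m (F n) (M n.+1) (M n)).

Let fin A : measurable A -> (m A < +oo)%E.
Proof. by move=> mA; rewrite ltey_eq fin_num_measure. Qed.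

Lemma filtration_le n k : (n <= k)%N -> F n `<=` F k.
Proof.
elim: k => [|k IH]; first by rewrite leqn0 => /eqP ->.
rewrite leq_eqVlt ltnS => /predU1P[->//|/IH nk].
exact: subset_trans nk (@F_mono k).
Qed.

Let M_adapted_le n k : (n <= k)%N ->
  measurable_fun [set: g_sigma_algebraType (F k)]
    (M n : g_sigma_algebraType (F k) -> R).
Proof.
move=> nk _ B mB; apply/(sub_sigmaP (F_alg k))/(filtration_le nk).
by apply/(sub_sigmaP (F_alg n)); exact: M_adapted.
Qed.

Let bM n : bounded_meas (M n).
Proof.
apply: bounded_meas01 => // _ B mB; apply: (@F_meas n).
by apply/(sub_sigmaP (F_alg n)); exact: M_adapted.
Qed.

Lemma martingale_le n k : (n <= k)%N -> same_integrals m (F n) (M k) (M n).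
Proof.
elim: k => [|k IH]; first by rewrite leqn0 => /eqP ->.
rewrite leq_eqVlt ltnS => /predU1P[->//|nk] A FA.
by rewrite M_mart ?IH//; exact: (filtration_le nk).
Qed.

(** [M n] is already [F k]-measurable, so it comes out of the conditional expectation of [M N] given
    [F k]. *)
Let cross n k N A : (n <= k)%N -> (k <= N)%N -> F k A ->
  \int[m]_(x in A) (M n x * M N x) = \int[m]_(x in A) (M n x * M k x).
Proof.
move=> nk kN; apply: (same_integralsM (F := F k)) => //.
- exact: M_adapted_le.
- exact: (bM N).1.
- exact: (bM k).1.
- exact: martingale_le.
Qed.

Let sqdiff n k (x : X) := (M k x - M n x) ^+ 2.

Let bsq n k : bounded_meas (sqdiff n k).
Proof.
rewrite /sqdiff; under eq_fun do rewrite expr2.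
by apply: bounded_measM; exact: bounded_measB.
Qed.

Let bMM n k : bounded_meas (fun x => M n x * M k x).
Proof. exact: bounded_measM. Qed.

Let sqdiff_ge0 n k A : 0 <= \int[m]_(x in A) sqdiff n k x.
Proof. by apply: Rintegral_ge0 => x _; exact: sqr_ge0. Qed.

(** Successive increments are orthogonal over sets of [F k]: the cross term 2(M_k - M_n)(M_N - M_k)
    integrates to 0 by [cross]. *)
Lemma martingale_pythagoras n k N A : (n <= k)%N -> (k <= N)%N -> F k A ->
  \int[m]_(x in A) sqdiff n N x =
  \int[m]_(x in A) sqdiff n k x + \int[m]_(x in A) sqdiff k N x.
Proof.
move=> nk kN FA; have mA := F_meas FA.
have int f : bounded_meas f -> m.-integrable A (EFin \o f).
  by apply: bounded_meas_integrable => //; exact: fin.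
have H : \int[m]_(x in A) (sqdiff n N x - sqdiff n k x - sqdiff k N x) = 0.
  have -> : \int[m]_(x in A) (sqdiff n N x - sqdiff n k x - sqdiff k N x) =
     \int[m]_(x in A) (2 * ((M k x * M N x - M k x * M k x) -
                            (M n x * M N x - M n x * M k x))).
    by apply: eq_Rintegral => x _; rewrite /sqdiff; ring.
  rewrite RintegralZl//; last by apply: int; do 2 apply: bounded_measB => //.
  rewrite RintegralB//; [|exact/int/bounded_measB..].
  rewrite !RintegralB//; [|exact: int..].
  by rewrite !(cross _ kN)// !subrr mulr0.
move: H; rewrite RintegralB//; [|exact/int/bounded_measB|exact: int].
rewrite RintegralB//; [lra|exact: int..].
Qed.

(** The growth of these second moments measures squared L2 increments; being bounded by 1, they
    leave arbitrarily little growth after a suitable time. *)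
Let E n := \int[m]_x (M n x * M n x).

Let sqdiffE n N : (n <= N)%N -> \int[m]_x sqdiff n N x = E N - E n.
Proof.
move=> nN; have int f : bounded_meas f -> m.-integrable setT (EFin \o f).
  by apply: bounded_meas_integrable => //; exact: fin.
have FT : F n setT by apply/(sub_sigmaP (F_alg n)).
rewrite /E -RintegralB//; [|exact: int..].
have -> : \int[m]_x sqdiff n N x = \int[m]_x ((M N x * M N x - M n x * M n x)
    - 2 * (M n x * M N x - M n x * M n x)).
  by apply: eq_Rintegral => x _; rewrite /sqdiff; ring.
rewrite [LHS]RintegralB//; last 2 first.
- by apply: int; apply: bounded_measB; exact: bMM.
- by apply: int; apply: bounded_measZ; apply: bounded_measB; exact: bMM.
rewrite RintegralZl//; last by apply: int; apply: bounded_measB; exact: bMM.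
rewrite [X in _ - 2 * X = _]RintegralB//; [|exact: int..].
by rewrite (cross (leqnn n) nN FT) subrr mulr0 subr0.
Qed.

Let E_ub : has_ubound (range E).
Proof.
exists 1 => _ [k _ <-].
have <- : \int[m]_(x in setT) 1 = 1.
  rewrite Rintegral_cst// mul1r -[RHS]/(fine 1%E); congr fine.
  exact: probability_setT.
apply: le_Rintegral => //.
- by apply: bounded_meas_integrable => //; exact: fin.
- by apply: bounded_meas_integrable => //; [exact: fin|exact: bounded_meas_cst].
- by move=> x _; have /andP[? ?] := M01 k x; rewrite mulr_ile1.
Qed.

Section maximal.
Variables (n : nat) (e : R).
Hypothesis e0 : 0 < e.

Let D i : set X := [set x | e <= `|M (n + i) x - M n x|].

Let FD i : F (n + i) (D i).
Proof.
pose Y := g_sigma_algebraType (F (n + i)).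
have mf : measurable_fun [set: Y] (fun x : Y => `|M (n + i) x - M n x|).
  apply: measurableT_comp => //; apply: measurable_funB; first exact: M_adapted_le.
  by apply: M_adapted_le; exact: leq_addr.
have := mf measurableT _ (measurable_itv `[e, +oo[).
rewrite setTI => /(sub_sigmaP (F_alg _)); congr (F _ _).
by apply/seteqP; split => x /=; rewrite in_itv/= andbT.
Qed.

Let FU L i : (L <= i)%N -> F (n + i) (\big[setU/set0]_(j < L) D j).
Proof.
move=> Li; apply/(sub_sigmaP (F_alg _)).
apply: bigsetU_measurable => j _; apply/(sub_sigmaP (F_alg _)).
apply: (@filtration_le (n + j)); last exact: FD.
by rewrite leq_add2l (leq_trans (ltnW (ltn_ord j))).
Qed.

Let FS i : F (n + i) (D i `\` \big[setU/set0]_(j < i) D j).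
Proof.
apply/(sub_sigmaP (F_alg _))/measurableD; apply/(sub_sigmaP (F_alg _)) => //.
exact: FU.
Qed.

(** Kolmogorov's inequality by first passage. The part of [D L] outside the earlier [D j] lies in
    [F (n + L)]; over it the Pythagorean identity at time [n + L] keeps the square of the increment
    from [n], at least [e ^+ 2]. The condition [L <= K.+1] says that no [j < L] exceeds the final
    index [K]. *)
Lemma martingale_maximal L K : (L <= K.+1)%N ->
  e ^+ 2 * fine (m (\big[setU/set0]_(j < L) D j)) <=
  \int[m]_(x in \big[setU/set0]_(j < L) D j) sqdiff n (n + K) x.
Proof.
elim: L => [_|L IH LK].
  by rewrite big_ord0 measure0 mulr0 Rintegral_set0.
rewrite big_ord_recr/=; set U := \big[setU/set0]_(j < L) D j.
have -> : U `|` D L = U `|` (D L `\` U).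
  by apply/seteqP; split => x [?|]; [left|have [?|?] := pselect (U x);
    [left|right]|left|case; right].
set S := D L `\` U.
have LK' : (L <= K)%N by rewrite -ltnS.
have mS : measurable S by apply: F_meas; exact: (FS L).
have mU : measurable U by apply: F_meas; exact: (FU (leqnn L)).
have US : U `&` S = set0 by apply/seteqP; split => // x [? []].
have int A f : measurable A -> bounded_meas f -> m.-integrable A (EFin \o f).
  by move=> mA; apply: bounded_meas_integrable => //; exact: fin.
rewrite measureU// fineD ?fin_num_measure// mulrDr Rintegral_setU//; last 2 first.
- by apply: int => //; exact: measurableU.
- exact/disj_set2P.
apply: lerD; first exact/IH/ltnW.
have LKn : (n + L <= n + K)%N by rewrite leq_add2l.
rewrite (martingale_pythagoras (leq_addr L n) LKn (FS L)).
rewrite -[leLHS]addr0 lerD// -Rintegral_cst//; apply: le_Rintegral => //.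
- by apply: int => //; exact: bounded_meas_cst.
- exact: int.
- move=> x [DL _]; rewrite /sqdiff -[leRHS]real_normK ?num_real//.
  by rewrite lerXn2r// nnegrE// ltW.
Qed.

Lemma martingale_maximal_fin L :
  (m (\big[setU/set0]_(j < L) D j) <= ((sup (range E) - E n) / e ^+ 2)%:E)%E.
Proof.
have mU : measurable (\big[setU/set0]_(j < L) D j).
  by apply: F_meas; exact: (FU (leqnn L)).
rewrite -[leLHS]fineK ?fin_num_measure// lee_fin ler_pdivlMr ?exprn_gt0//.
rewrite mulrC; apply: le_trans (martingale_maximal (leqnSn L)) _.
apply: (@le_trans _ _ (E (n + L) - E n)); last first.
  by rewrite lerD2r; apply: (ub_le_sup E_ub); exists (n + L)%N.
rewrite -sqdiffE ?leq_addr//; apply: fine_le.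
- apply: integrable_fin_num => //; apply: bounded_meas_integrable => //; exact: fin.
- apply: integrable_fin_num => //; apply: bounded_meas_integrable => //; exact: fin.
- apply: ge0_subset_integral => //.
  + exact/measurable_EFinP/(bsq _ _).1.
  + by move=> x _; rewrite lee_fin sqr_ge0.
Qed.

Lemma martingale_maximal_all : measurable (\bigcup_j D j) /\
  (m (\bigcup_j D j) <= ((sup (range E) - E n) / e ^+ 2)%:E)%E.
Proof.
have mD j : measurable (D j) by apply: F_meas; exact: (FD j).
have mDD : measurable (\bigcup_j D j) by exact: bigcupT_measurable.
split => //.
have UD : \bigcup_L (\big[setU/set0]_(j < L) D j) = \bigcup_j D j.
  apply/seteqP; split=> x [L _]; first by rewrite -bigcup_mkord => -[j _ Dj]; exists j.
  by move=> DL; exists L.+1 => //; rewrite -bigcup_mkord; exists L => /=.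
have H : m (\big[setU/set0]_(j < L) D j) @[L --> \oo] --> m (\bigcup_j D j).
  rewrite -UD; apply: nondecreasing_cvg_mu.
  - by move=> L; exact: bigsetU_measurable.
  - by rewrite UD.
  - by move=> i j ij; apply/subsetPset; exact: subset_bigsetU.
rewrite -(cvg_lim _ H)//; apply: lime_le; first by apply/cvg_ex; eexists; exact: H.
by apply: nearW => L; exact: martingale_maximal_fin.
Qed.

End maximal.

(** A sequence that is not Cauchy lies in some [B i]: after every time [n] it moves at least 1/(i+1)
    away from [M n]. The maximal inequality bounds the mass of [B i] for every [n], and the bounds
    have infimum 0. *)
Theorem martingale_cvg : {ae m, forall x, cvgn (M ^~ x)}.
Proof.
pose S n e := \bigcup_j [set x | e <= `|M (n + j) x - M n x|].
pose B i : set X := \bigcap_n S n i.+1%:R^-1.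
have i0 (i : nat) : 0 < i.+1%:R^-1 :> R by rewrite invr_gt0.
have mB i : measurable (B i).
  by apply: bigcapT_measurable => n; exact: (martingale_maximal_all n (i0 i)).1.
have B0 i : m (B i) = 0%E.
  apply/eqP; rewrite -measure_le0; apply/lee_addgt0Pr => r r0; rewrite add0e.
  have hs : has_sup (range E) by split; [exists (E 0%N), 0%N|exact: E_ub].
  (* This tolerance becomes [r] after the division by the squared threshold in the maximal
     inequality. *)
  have r'0 : 0 < r * i.+1%:R^-1 ^+ 2 by rewrite mulr_gt0// exprn_gt0.
  have [_ [n _ <-] Hn] := sup_adherent r'0 hs.
  have [mS HS] := martingale_maximal_all n (i0 i).
  apply: (@le_trans _ _ (m (S n i.+1%:R^-1))).
    by apply: le_measure; rewrite ?inE//; exact: bigcap_inf.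
  apply: le_trans HS _; rewrite lee_fin ler_pdivrMr ?exprn_gt0//.
  by rewrite lerBlDr addrC -lerBlDr ltW.
exists (\bigcup_i B i); split.
- exact: bigcupT_measurable.
- apply/(negligibleP _ (bigcupT_measurable _ mB)).1/negligible_bigcup => i.
  exact/(negligibleP _ (mB i)).2/B0.
move=> x /= ncvg; apply: contrapT => nB; apply: ncvg.
apply: cauchy_cvg; apply: cauchy_exP => e e0.
have [i ie] : exists i : nat, i.+1%:R^-1 < e 
  by have [i] := ltr_add_invr e0; rewrite add0r => ?; exists i.
have : ~ B i x by move=> Bi; apply: nB; exists i.
rewrite /B /bigcap/= => /existsNP[n /not_implyP[_ nS]].
exists (M n x), n => // k /= nk; rewrite /ball/=.
rewrite ltNge; apply/negP => ek; apply: nS; exists (k - n)%N => //=.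
by rewrite subnKC// distrC (le_trans (ltW ie)).
Qed.

End martingale.

(** * Disintegration *)

Section equal_mod0.
Context (R : realType) d (X : measurableType d) (m : probability X R).
Implicit Types A B C : set X.

Definition eqmod0 A B := m.-negligible ((A `\` B) `|` (B `\` A)).

Lemma eqmod0_refl A : eqmod0 A A.
Proof. by rewrite /eqmod0 setDv setU0; exact: negligible_set0. Qed.

Lemma eqmod0_trans A B C : eqmod0 A B -> eqmod0 B C -> eqmod0 A C.
Proof.
move=> AB BC; apply: negligibleS (negligibleU AB BC) => x /=.
by have [?|?] := pselect (B x); tauto.
Qed.

Lemma eqmod0C A B : eqmod0 A B -> eqmod0 (~` A) (~` B).
Proof.
apply: negligibleS => x [[/= ? /contrapT ?]|[/= ? /contrapT ?]]; [right|left];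
  by split.
Qed.

Lemma eqmod0_bigcup (A B : nat -> set X) : (forall n, eqmod0 (A n) (B n)) ->
  eqmod0 (\bigcup_n A n) (\bigcup_n B n).
Proof.
move=> AB; apply: negligibleS (negligible_bigcup AB) => x.
by case=> -[[n _ ?] nn]; exists n => //; [left|right]; split => // ?;
  apply: nn; exists n.
Qed.

(** Completion inside the given sigma-algebra: null differences are allowed, but only measurable
    sets are kept, so integrals over members make sense. *)
Definition mod0_sat (S : set (set X)) : set (set X) :=
  [set A | measurable A /\ exists2 B, S B & eqmod0 A B].

Lemma mod0_sat_sigma_algebra S : sigma_algebra setT S ->
  sigma_algebra setT (mod0_sat S).
Proof.
move=> [S0 SC SU]; split.
- by split; [exact: measurable0 | exists set0 => //; exact: eqmod0_refl].
- move=> A [mA [B SB AB]]; rewrite setTD; split; first exact: measurableC.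
  by exists (~` B); [rewrite -setTD; exact: SC | exact: eqmod0C].
- move=> A HA; split; first by apply: bigcupT_measurable => n; case: (HA n).
  have /choice[B HB] n : exists B, S B /\ eqmod0 (A n) B.
    by have [_ [B]] := HA n; exists B.
  exists (\bigcup_n B n); first by apply: SU => n; case: (HB n).
  by apply: eqmod0_bigcup => n; case: (HB n).
Qed.

Lemma Rintegral_eqmod0 A B f : measurable A -> measurable B -> eqmod0 A B ->
  bounded_meas f -> \int[m]_(x in A) f x = \int[m]_(x in B) f x.
Proof.
move=> mA mB [N [mN N0 ABN]] bf; congr fine.
have int C : measurable C -> m.-integrable C (EFin \o f).
  move=> mC; apply: bounded_meas_integrable => //.
  by rewrite ltey_eq fin_num_measure.
rewrite (negligible_integral mN mA (int _ mA) N0).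
rewrite [RHS](negligible_integral mN mB (int _ mB) N0); congr integral.
by apply/seteqP; split => x [? nN]; split => //; apply: contrapT => ?;
  apply: nN; apply: ABN; [left|right].
Qed.

Lemma Rintegral_ae A f h : measurable A -> bounded_meas f -> bounded_meas h ->
  {ae m, forall x, f x = h x} ->
  \int[m]_(x in A) f x = \int[m]_(x in A) h x.
Proof.
move=> mA [mf _] [mh _] fh; congr fine; apply: ae_eq_integral => //.
- exact/measurable_EFinP/measurable_funTS.
- exact/measurable_EFinP/measurable_funTS.
- by apply: filterS fh => x -> .
Qed.

End equal_mod0.

Lemma sigma_algebra_preim (X Y : Type) (f : X -> Y) (S : set (set X)) :
  sigma_algebra setT S -> sigma_algebra setT [set A | S (f @^-1` A)].
Proof.
move=> [S0 SC SU]; split => /=.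
- by rewrite preimage_set0.
- by move=> A SA; rewrite setTD preimage_setC -setTD; exact: SC.
- by move=> A SA; rewrite preimage_bigcup; exact: SU.
Qed.

Section measure_preserving.
Context (R : realType) d (X : measurableType d) (m : probability X R).
Variable T : X -> X.
Hypotheses (mT : measurable_fun [set: X] T)
  (Tm : forall A, measurable A -> m (T @^-1` A) = m A).

Lemma preimage_measurable A : measurable A -> measurable (T @^-1` A).
Proof. by move=> mA; rewrite -[X in measurable X]setTI; exact: mT. Qed.

Lemma negligible_preimage A : m.-negligible A -> m.-negligible (T @^-1` A).
Proof.
move=> [N [mN N0 AN]]; exists (T @^-1` N); split; last by move=> x /AN.
- exact: preimage_measurable.
- by rewrite Tm.
Qed.

Lemma ae_preimage (P : X -> Prop) : {ae m, forall x, P x} ->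
  {ae m, forall x, P (T x)}.
Proof. exact: negligible_preimage. Qed.

Lemma eqmod0_preimage A B : eqmod0 m A B -> eqmod0 m (T @^-1` A) (T @^-1` B).
Proof. exact: negligible_preimage. Qed.

Lemma Rintegral_preimage A f : measurable A -> bounded_meas f ->
  \int[m]_(x in A) f x = \int[m]_(x in T @^-1` A) f (T x).
Proof.
move=> mA [mf bf]; congr fine.
rewrite -(@integral_pushforward _ _ _ _ _ T mT m A (EFin \o f))//.
- apply: eq_measure_integral => B mB _; exact/esym/Tm.
- exact/measurable_EFinP.
- apply: (@bounded_meas_integrable _ _ _ m _ (f \o T)).
  + exact: preimage_measurable.
  + by rewrite ltey_eq fin_num_measure//; exact: preimage_measurable.
  + split; first exact: measurableT_comp.
    by have [c fc] := bf; exists c => x; exact: fc.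
Qed.

End measure_preserving.

Section disintegrate.
Context (R : realType) d (X : measurableType d) (m : probability X R)
  d' (Xp : measurableType d') (pp : X -> Xp) (mu : R.-pker Xp ~> X).
Hypotheses (mpp : measurable_fun [set: X] pp) (Hmu : disintegration m pp mu).

Lemma preimage_pp_measurable B : measurable B -> measurable (pp @^-1` B).
Proof. by move=> mB; rewrite -[X in measurable X]setTI; exact: mpp. Qed.

Lemma measurable_mu A : measurable A -> measurable_fun [set: Xp] (mu ^~ A).
Proof. exact: measurable_kernel. Qed.

Let disintE A B : measurable A -> measurable B ->
  (m : {measure set X -> \bar R}) (A `&` pp @^-1` B) =
  (\int[m]_(x in pp @^-1` B) mu (pp x) A)%E.
Proof.
move=> mA mB; rewrite [LHS]Hmu// ge0_integral_pushforward//.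
exact/measurable_funTS/measurable_mu.
Qed.

Import HBNNSimple.
Local Open Scope ereal_scope.

Let disint_nnsfun (f : {nnsfun X >-> R}) B : measurable B ->
  \int[m]_(x in pp @^-1` B) (f x)%:E =
  \int[m]_(x in pp @^-1` B) \int[mu (pp x)]_z (f z)%:E.
Proof.
move=> mB; have mpB := preimage_pp_measurable mB.
under [LHS]eq_integral do rewrite fimfunE -fsumEFin//.
rewrite ge0_integral_fsum//; last 2 first.
  - by move=> r; apply/measurable_EFinP/measurable_funTS/measurableT_comp.
  - by move=> r z _; rewrite EFinM nnfun_muleindic_ge0.
under [RHS]eq_integral.
  move=> y _.
  under eq_integral.
    by move=> z _; rewrite fimfunE -fsumEFin//; over.
  rewrite /= ge0_integral_fsum//; last 2 first.
    - by move=> r; exact/measurable_EFinP/measurableT_comp.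
    - by move=> r z _; rewrite EFinM nnfun_muleindic_ge0.
  under eq_fsbigr.
    move=> r _.
    rewrite (integralZl_indic _ (fun r => f @^-1` [set r]))//; last first.
      by move=> r0; rewrite preimage_nnfun0.
    rewrite integral_indic// setIT.
    over.
  over.
have mk r : measurable_fun [set: X] (fun x => mu (pp x) (f @^-1` [set r])).
  by apply: (@measurableT_comp _ _ _ _ _ _ (mu ^~ _)) => //; exact: measurable_mu.
rewrite /= ge0_integral_fsum//; last 2 first.
  - by move=> r; apply: measurable_funTS; exact: measurable_funeM.
  - move=> n y _.
    have := mulemu_ge0 (fun n => f @^-1` [set n]).
    by apply; exact: preimage_nnfun0.
apply: eq_fsbigr => r _.
rewrite (integralZl_indic _ (fun r => f @^-1` [set r]))//; last first.
  exact: preimage_nnfun0.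
rewrite integral_indic// disintE//.
have [r0|r0] := leP 0%R r.
  by rewrite ge0_integralZl//; exact: measurable_funTS.
rewrite preimage_nnfun0//.
by rewrite !integral0_eq ?mule0// => y _; rewrite measure0 ?mule0.
Qed.

(** The hypothesis on [mu] concerns sets only. Simple functions follow by linearity, the rest by
    monotone convergence in both the inner and the outer integral. *)
Lemma ge0_integral_disint (f : X -> \bar R) B : measurable B ->
  (forall x, 0 <= f x) -> measurable_fun [set: X] f ->
  \int[m]_(x in pp @^-1` B) f x =
  \int[m]_(x in pp @^-1` B) \int[mu (pp x)]_z f z.
Proof.
move=> mB f0 mf; have mpB := preimage_pp_measurable mB.
pose f_ := nnsfun_approx measurableT mf.
have mk n : measurable_fun [set: X] (fun x => \int[mu (pp x)]_z (f_ n z)%:E).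
  apply: (@measurableT_comp _ _ _ _ _ _ (fun y => \int[mu y]_z (f_ n z)%:E)) => //.
  apply: measurable_fun_integral_kernel => //.
  - by move=> U mU; exact: measurable_mu.
  - by move=> z; rewrite lee_fin.
  - exact/measurable_EFinP.
transitivity (\int[m]_(x in pp @^-1` B) (lim ((f_ n x)%:E @[n --> \oo]))).
  by apply/eq_integral => z _; apply/esym/cvg_lim => //=; exact: cvg_nnsfun_approx.
rewrite monotone_convergence//; last 3 first.
- by move=> n; exact/measurable_EFinP/measurable_funTS.
- by move=> n z _; rewrite lee_fin.
- by move=> z _ a b ab; rewrite lee_fin; exact/lefP/nd_nnsfun_approx.
under eq_fun do rewrite disint_nnsfun//.
rewrite -monotone_convergence//; last 3 first.
- by move=> n; exact: measurable_funTS.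
- by move=> n y _; apply: integral_ge0 => // z _; rewrite lee_fin.
- move=> y _ a b ab; apply: ge0_le_integral => //.
  + by move=> z _; rewrite lee_fin.
  + exact/measurable_EFinP.
  + exact/measurable_EFinP.
  + by move=> z _; rewrite lee_fin; exact/lefP/nd_nnsfun_approx.
apply: eq_integral => y _; rewrite -monotone_convergence//; last 3 first.
- by move=> n; exact/measurable_EFinP.
- by move=> n z _; rewrite lee_fin.
- by move=> z _ a b ab; rewrite lee_fin; exact/lefP/nd_nnsfun_approx.
by apply: eq_integral => z _; apply/cvg_lim => //; exact: cvg_nnsfun_approx.
Qed.

Local Close Scope ereal_scope.

Let muoo y : (mu y [set: X] < +oo)%E.
Proof. by rewrite prob_kernel ltry. Qed.

Variables (Q : set (V R)) (HQ : metrizable_ccs Q).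

(** Each [mu y] has mass 1, so the integral is a mean over the whole space and lies in [Q] for every
    [y], with no exceptional set. *)
Lemma Qmap_Fplus f : Qmap Q f -> Qmap Q (Fplus mu f).
Proof.
move=> Qf; have bf := Qmap_bounded_meas HQ Qf; split => [y|k].
  have -> : Fplus mu f y = mean (mu y) setT f.
    by apply/funext => k; rewrite /mean prob_kernel/= invr1 mul1r.
  by apply: mean_mem => //; rewrite prob_kernel lte01.
have [_ Q01 _ _] := HQ.
apply: (@measurableT_comp _ _ _ _ _ _ fine) => //.
apply: measurable_fun_integral_kernel.
- by move=> U mU; exact: measurable_mu.
- by move=> x; rewrite lee_fin; have /andP[] := Q01 _ (Qf.1 x) k.
- exact/measurable_EFinP/(bf k).1.
Qed.

Lemma Rintegral_Fplus f B k : Qmap Q f -> measurable B ->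
  \int[m]_(x in pp @^-1` B) f x k = \int[m]_(x in pp @^-1` B) Fplus mu f (pp x) k.
Proof.
move=> Qf mB; have bf := Qmap_bounded_meas HQ Qf; have [_ Q01 _ _] := HQ.
congr fine; rewrite ge0_integral_disint//; last 2 first.
- by move=> x; rewrite lee_fin; have /andP[] := Q01 _ (Qf.1 x) k.
- exact/measurable_EFinP/(bf k).1.
apply: eq_integral => x _; rewrite /Fplus /vint fineK//.
by apply: integrable_fin_num => //; exact: bounded_meas_integrable.
Qed.

End disintegrate.

(** * Passage to the limit and extension from pi-systems *)

Lemma cvg_ptws_seq (R : realType) (u : nat -> V R) (b : V R) :
  (forall k, (fun n => u n k : R) @ \oo --> (b k : R)) -> u @ \oo --> b.
Proof.
move=> H; have FF := fmap_filter u eventually_filter.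
exact: (cvg_coordP (FF := FF) b).2.
Qed.

Lemma closed_cvg_seq (R : realType) (Q : set (V R)) (u : nat -> V R) (b : V R) :
  closed Q -> (forall n, Q (u n)) -> u @ \oo --> b -> Q b.
Proof.
move=> Qcl Qu ub; apply: Qcl => U /ub [n _ nU].
by exists (u n); split; [exact: Qu|exact: (nU n (leqnn n))].
Qed.

Lemma cvg_slice (R : realType) (Q : set (V R)) (a : V R -> R)
    (u : nat -> V R) (b : V R) :
  {within Q, continuous a} -> (forall n, Q (u n)) -> Q b ->
  u @ \oo --> b -> (fun n => a (u n)) @ \oo --> a b.
Proof.
move=> /subspace_continuousP ac Qu Qb ub P /(ac _ Qb)/ub[n _ nP].
by exists n => // j /nP/(_ (Qu j)).
Qed.

Section bounded_convergence.
Context (R : realType) d (X : measurableType d) (m : probability X R).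

Lemma cvg_Rintegral01 (f_ : nat -> X -> R) (f : X -> R) A : measurable A ->
  (forall n, measurable_fun [set: X] (f_ n)) -> measurable_fun [set: X] f ->
  (forall n x, 0 <= f_ n x <= 1) ->
  {ae m, forall x, f_ ^~ x @ \oo --> f x} ->
  \int[m]_(x in A) f_ n x @[n --> \oo] --> \int[m]_(x in A) f x.
Proof.
move=> mA mf_ mf f01 ff.
have Aoo : (m A < +oo)%E by rewrite ltey_eq fin_num_measure.
have [||||| int _ cv] := @dominated_convergence _ X R m A mA
    (fun n x => (f_ n x)%:E) (fun x => (f x)%:E) (cst 1%E).
- by move=> n; exact/measurable_EFinP/measurable_funTS.
- exact/measurable_EFinP/measurable_funTS.
- by apply: filterS ff => x fx _; apply/fine_cvgP; split => //; exact: nearW.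
- apply: (@bounded_meas_integrable _ _ _ m A (cst 1)) => //.
  exact: bounded_meas_cst.
- apply: aeW => x n _ /=; rewrite lee_fin.
  by have /andP[? ?] := f01 n x; rewrite ger0_norm.
have fi := integrable_fin_num mA int.
by move: cv; rewrite -(fineK fi) => /fine_cvgP[].
Qed.

End bounded_convergence.

Section integral_pi_system.
Context (R : realType) d (X : measurableType d) (m : probability X R).
Variables (f h : X -> R).
Hypotheses (mf : measurable_fun [set: X] f) (mh : measurable_fun [set: X] h)
  (f01 : forall x, 0 <= f x <= 1) (h01 : forall x, 0 <= h x <= 1).

Let fin A : measurable A -> (m A < +oo)%E.
Proof. by move=> mA; rewrite ltey_eq fin_num_measure. Qed.

(** Dynkin's argument: agreement of integrals passes to complements, since it holds on the whole
    space, and to countable disjoint unions. *)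
Lemma same_integrals_sigma (S : set (set X)) :
  setI_closed S -> S setT -> S `<=` measurable ->
  same_integrals m S f h -> same_integrals m <<s S >> f h.
Proof.
move=> SI ST Sm fh.
have bf := bounded_meas01 mf f01; have bh := bounded_meas01 mh h01.
have int A u : measurable A -> bounded_meas u -> m.-integrable A (EFin \o u).
  by move=> mA; apply: bounded_meas_integrable => //; exact: fin.
pose D : set (set X) :=
  [set A | measurable A /\ \int[m]_(x in A) f x = \int[m]_(x in A) h x].
suff : <<s S >> `<=` D by move=> H A /H[].
rewrite -setI_closed_g_dynkin_g_sigma_algebra//; apply: smallest_sub; last first.
  by move=> A SA; split; [exact: Sm|exact: fh].
have DT : D setT by split => //; exact: fh.
split => // [A [mA fhA]|A tA DA].
  split; first exact: measurableC.
  have split_int u : bounded_meas u ->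
      \int[m]_(x in ~` A) u x = \int[m]_x u x - \int[m]_(x in A) u x.
    move=> bu; rewrite -(setvU A) Rintegral_setU//.
    - by rewrite addrK.
    - exact: measurableC.
    - by rewrite setvU; exact: int.
    - by apply/disj_set2P; rewrite setICl.
  by rewrite !split_int// fhA DT.2.
have mA n : measurable (A n) by case: (DA n).
split; first exact: bigcupT_measurable.
congr fine; rewrite !ge0_integral_bigcup//; last 4 first.
- exact/measurable_EFinP/measurable_funTS.
- by move=> x _; rewrite lee_fin; have /andP[] := h01 x.
- exact/measurable_EFinP/measurable_funTS.
- by move=> x _; rewrite lee_fin; have /andP[] := f01 x.
apply: eq_eseriesr => n _; have [_] := DA n; rewrite /Rintegral => fhn.
rewrite -[LHS]fineK ?fhn ?fineK//; apply: integrable_fin_num => //; exact: int.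
Qed.

Lemma same_integrals_ae : same_integrals m measurable f h ->
  {ae m, forall x, f x = h x}.
Proof.
move=> fh.
have bf := bounded_meas01 mf f01; have bh := bounded_meas01 mh h01.
have int A u : measurable A -> bounded_meas u -> m.-integrable A (EFin \o u).
  by move=> mA; apply: bounded_meas_integrable => //; exact: fin.
have : ae_eq m setT (EFin \o f) (EFin \o h).
  apply: integral_ae_eq => //; first exact: int.
    exact/measurable_EFinP.
  move=> E _ mE; have := fh _ mE; rewrite /Rintegral => fhE.
  by rewrite -[LHS]fineK ?fhE ?fineK//; apply: integrable_fin_num => //; exact: int.
by apply: filterS => x /(_ I) [].
Qed.

End integral_pi_system.

(** * Equivariant and stationary maps *)

Section greg.
Context (R : realType) (d : measure_display) (X : measurableType d)
  (m : probability X R) (T Tinv : X -> X) (HT : inv_mp m T Tinv)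
  (G : topologicalType) (mul : G -> G -> G) (inv : G -> G) (one : G)
  (HG : lcsc_group mul inv one) (w : X -> G) (Hw : borel_meas w)
  (Q : set (V R)) (HQ : metrizable_ccs Q)
  (act : G -> V R -> V R) (Hact : cont_aff_action mul one Q act)
  (d' : measure_display) (Xp : measurableType d') (pp : X -> Xp)
  (Hpp : future_factor m T Tinv w pp)
  (mu : R.-pker Xp ~> X) (Hmu : disintegration m pp mu).

Let mT : measurable_fun [set: X] T. Proof. by case: HT. Qed.
Let mTinv : measurable_fun [set: X] Tinv. Proof. by case: HT. Qed.
Let TK : cancel T Tinv. Proof. by case: HT. Qed.
Let TinvK : cancel Tinv T. Proof. by case: HT. Qed.
Let Tm A : measurable A -> m (T @^-1` A) = m A. Proof. by case: HT => _ _ _ _; exact. Qed.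

Let Tinvm A : measurable A -> m (Tinv @^-1` A) = m A.
Proof.
move=> mA; rewrite -Tm; last exact: preimage_measurable.
by congr (m _); apply/seteqP; split => x /=; rewrite TK.
Qed.

Let mpp : measurable_fun [set: X] pp. Proof. by case: Hpp. Qed.

Let G2 : @second_countable G. Proof. by case: HG => _ _ _ _ [_ []]. Qed.

Let Q01 q : Q q -> forall k, 0 <= q k <= 1. Proof. by case: HQ => _ + _ _; exact. Qed.

Let actQ g q : Q q -> Q (act g q). Proof. by case: Hact => + _ _ _ _; exact. Qed.

Let m_iter S n : measurable_fun [set: X] S -> measurable_fun [set: X] (iter n S).
Proof.
move=> mS; elim: n => [|n IH]; first exact: measurable_id.
exact: (measurableT_comp mS IH).
Qed.

Let iterK n : cancel (iter n T) (iter n Tinv).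
Proof. by elim: n => // n IH x; rewrite iterSr/= TK IH. Qed.

Let iterKinv n : cancel (iter n Tinv) (iter n T).
Proof. by elim: n => // n IH x; rewrite iterSr/= TinvK IH. Qed.

Definition future_algebra := mod0_sat m <<s wsets T Tinv w true >>.

(* [filt n] is the completed sigma-algebra generated by [w o T^k], [k >= -n]. *)
Definition filt n : set (set X) := [set A | future_algebra (iter n T @^-1` A)].

Lemma filt_sigma_algebra n : sigma_algebra setT (filt n).
Proof.
apply/sigma_algebra_preim/mod0_sat_sigma_algebra; exact: smallest_sigma_algebra.
Qed.

Lemma filt_measurable n : filt n `<=` measurable.
Proof.
move=> A [mA _].
have -> : A = iter n Tinv @^-1` (iter n T @^-1` A).
  by apply/seteqP; split => x /=; rewrite iterKinv.
by apply: preimage_measurable => //; exact: m_iter.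
Qed.

Lemma wsets_measurable b : wsets T Tinv w b `<=` measurable.
Proof.
move=> _ [k [U [oU [->|[_ ->]]]]].
- have := preimage_measurable (m_iter k mT) (Hw oU); exact.
- have := preimage_measurable (m_iter k mTinv) (Hw oU); exact.
Qed.

Lemma gen_measurable b : <<s wsets T Tinv w b >> `<=` measurable.
Proof.
apply: smallest_sub; first exact: sigma_algebra_measurable.
exact: wsets_measurable.
Qed.

Lemma future_algebra_gen : <<s wsets T Tinv w true >> `<=` future_algebra.
Proof.
move=> A sA; split; first exact: (gen_measurable sA).
by exists A => //; exact: eqmod0_refl.
Qed.

(** Taking preimages under [T] turns w o T^k into w o T^(k+1), so the future algebra is mapped into
    itself; null differences survive because [T] preserves [m]. *)
Lemma filt_mono n : filt n `<=` filt n.+1.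
Proof.
have H : future_algebra `<=` filt 1.
  move=> A [mA [B sB AB]]; split; first exact: preimage_measurable.
  exists (T @^-1` B); last exact: eqmod0_preimage.
  have : <<s wsets T Tinv w true >> `<=`
      [set B | <<s wsets T Tinv w true >> (T @^-1` B)].
    apply: smallest_sub.
      exact/sigma_algebra_preim/smallest_sigma_algebra.
    move=> _ [k [U [oU [->|[]//]]]]; apply: sub_sigma_algebra.
    exists k.+1, U; split => //; left.
    by apply/seteqP; split => x; rewrite /= -iterSr.
  exact.
move=> A /H; rewrite /filt/=; congr future_algebra.
by apply/seteqP; split => x; rewrite /= -iterS iterSr.
Qed.

Lemma filt_le n k : (n <= k)%N -> filt n `<=` filt k.
Proof. exact: (filtration_le filt_mono). Qed.

Lemma w_filt n U : open U -> filt n (w @^-1` U).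
Proof.
move=> oU; apply: (filt_le (leq0n n)); apply: future_algebra_gen.
by apply: sub_sigma_algebra; exists 0%N, U; split => //; left.
Qed.

Lemma pp_filt B : measurable B -> filt 0 (pp @^-1` B).
Proof.
move=> mB; have [_ + _] := Hpp => /(_ (pp @^-1` B))[|C sC BC]; first by exists B.
by split; [exact: (preimage_pp_measurable mpp mB)|exists C].
Qed.

Lemma filt_pp A : filt 0 A -> exists2 B, measurable B & eqmod0 m A (pp @^-1` B).
Proof.
move=> [_ [C sC AC]]; have [_ _ /(_ C sC)[_ [B mB <-] CB]] := Hpp.
by exists B => //; exact: eqmod0_trans AC CB.
Qed.

Lemma same_integrals_pp f h : bounded_meas f -> bounded_meas h ->
  (forall B, measurable B ->
    \int[m]_(x in pp @^-1` B) f x = \int[m]_(x in pp @^-1` B) h x) ->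
  same_integrals m (filt 0) f h.
Proof.
move=> bf bh fh A FA; have mA := filt_measurable FA.
have [B mB AB] := filt_pp FA; have mpB := preimage_pp_measurable mpp mB.
by rewrite !(Rintegral_eqmod0 mA mpB AB)// fh.
Qed.

Let bnd f : Qmap Q f -> forall k, bounded_meas (fun x : X => f x k).
Proof. exact: Qmap_bounded_meas. Qed.

Lemma Qmap_comp d1 (Y : measurableType d1) d2 (Z : measurableType d2)
    (f : Y -> V R) (s : Z -> Y) : measurable_fun [set: Z] s ->
  Qmap Q f -> Qmap Q (f \o s).
Proof.
by move=> ms [fQ mf]; split=> [x|k]; [exact: fQ|exact: (measurableT_comp (mf k) ms)].
Qed.

(** The bridge between [Xp] and [X]. Stationarity is the case where [f] is the transfer of
    [psi \o pp], and recovery of [psi] from the limit is the case [f = phi]; afterwards all work is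
    done with integrals on [X]. *)
Lemma ae_FplusP f psi : Qmap Q f -> Qmap Q psi ->
  {ae mplus m pp, forall y, psi y = Fplus mu f y} <->
  forall k, same_integrals m (filt 0) (fun x => f x k) (fun x => psi (pp x) k).
Proof.
move=> Qf Qpsi; have QF := Qmap_Fplus mu HQ Qf.
have Qpp : Qmap Q (psi \o pp) by exact: Qmap_comp.
have QFpp : Qmap Q (Fplus mu f \o pp) by exact: Qmap_comp.
split => [H k|H].
  apply: same_integrals_pp => [||B mB]; [exact: bnd|exact: (bnd Qpp)|].
  rewrite (Rintegral_Fplus mpp Hmu HQ)//; apply: Rintegral_ae.
  - exact: preimage_pp_measurable.
  - exact: (bnd QFpp).
  - exact: (bnd Qpp).
  have [N [mN N0 HN]] := H; exists (pp @^-1` N); split => //.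
    exact: preimage_pp_measurable.
  by move=> x /= nx; apply: HN => /= E; apply: nx; rewrite E.
(* The measure structure of the pushforward depends on the proof [mpp], so it is named
   explicitly. *)
pose mp : {measure set Xp -> \bar R} :=
  measure_function_pushforward__canonical__measure_function_Measure m mpp.
suff : {ae mp, forall y k, psi y k = Fplus mu f y k}.
  by apply: filterS => y E; apply/funext.
apply: ae_foralln => k.
have int psi' : Qmap Q psi' -> mp.-integrable setT (fun y => (psi' y k)%:E).
  move=> Qp; apply: (@bounded_meas_integrable _ Xp R mp setT (fun y => psi' y k)) => //.
    rewrite /mp/= /pushforward preimage_setT.
    by rewrite ltey_eq fin_num_measure.
  exact: (Qmap_bounded_meas HQ Qp).
have E0 psi' y : Qmap Q psi' -> (0 <= (psi' y k)%:E :> \bar R)%E.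
  by move=> Qp; rewrite lee_fin; have /andP[] := Q01 (Qp.1 y) k.
have : ae_eq mp setT (fun y => (psi y k)%:E) (fun y => (Fplus mu f y k)%:E).
  apply: integral_ae_eq => //; first exact: int.
    exact/measurable_EFinP/QF.2.
  move=> B _ mB; have mpB := preimage_pp_measurable mpp mB.
  have mk psi' : Qmap Q psi' -> measurable_fun B (fun y => (psi' y k)%:E).
    by move=> Qp; apply/measurable_EFinP/measurable_funTS/Qp.2.
  have intx psi' : Qmap Q psi' ->
      m.-integrable (pp @^-1` B) ((fun y => (psi' y k)%:E) \o pp).
    move=> Qp; apply: (@bounded_meas_integrable _ X R m _ (fun x => psi' (pp x) k)) => //.
      by rewrite ltey_eq fin_num_measure.
    exact: (bnd (Qmap_comp mpp Qp)).
  rewrite [LHS](ge0_integral_pushforward mpp)//; [|exact: mk|by move=> y _; exact: E0].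
  rewrite [RHS](ge0_integral_pushforward mpp)//; [|exact: mk|by move=> y _; exact: E0].
  rewrite -[LHS]fineK; last exact: integrable_fin_num (intx _ _).
  rewrite -[RHS]fineK; last exact: integrable_fin_num (intx _ _).
  congr EFin.
  have := H k _ (pp_filt mB).
  by rewrite (Rintegral_Fplus mpp Hmu HQ)// => /esym.
by apply: filterS => y /(_ I) [].
Qed.

Lemma act_coord_continuous k :
  {within [set: G] `*` Q, continuous (fun p : G * V R => act p.1 p.2 k : R)}.
Proof.
have [_ _ _ _ /subspace_continuousP ca] := Hact.
apply/subspace_continuousP => p Qp P Pk.
exact: (ca p Qp _ (ptws_coord_continuous Pk)).
Qed.

Lemma Qmap_act d1 (Y : measurableType d1) (g : Y -> G) (f : Y -> V R) :
  borel_meas g -> Qmap Q f -> Qmap Q (fun y => act (g y) (f y)).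
Proof.
move=> mg Qf; split => [y|k]; first exact/actQ/Qf.1.
exact: (measurable_fun_box G2 (act_coord_continuous (k := k)) mg Qf).
Qed.

Definition transfer (f : X -> V R) (x : X) : V R :=
  act (w (Tinv x)) (f (Tinv x)).

Lemma Qmap_transfer f : Qmap Q f -> Qmap Q (transfer f).
Proof.
move=> Qf; have := Qmap_comp mTinv (Qmap_act Hw Qf); exact.
Qed.

Lemma Qmap_iter n f : Qmap Q f -> Qmap Q (iter n transfer f).
Proof. by move=> Qf; elim: n => // n IH; exact: Qmap_transfer. Qed.

Lemma same_integrals_transfer n f h : Qmap Q f -> Qmap Q h ->
  (forall k, same_integrals m (filt n) (fun x => f x k) (fun x => h x k)) ->
  forall k, same_integrals m (filt n.+1)
    (fun x => transfer f x k) (fun x => transfer h x k).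
Proof.
move=> Qf Qh fh k A FA; have mA := filt_measurable FA.
rewrite (Rintegral_preimage mT Tm mA (bnd (Qmap_transfer Qf) k)).
rewrite (Rintegral_preimage mT Tm mA (bnd (Qmap_transfer Qh) k)).
rewrite /transfer; under eq_Rintegral do rewrite TK.
under [RHS]eq_Rintegral do rewrite TK.
apply: (@same_integrals_act _ _ _ m (filt n) (filt_sigma_algebra n)
  (@filt_measurable n) Q HQ G (fun p => act p.1 p.2 k) w G2
  (@act_coord_continuous k) (fun U => @w_filt n U)) => //.
- move=> x t p q t01 Qp Qq /=.
  by have [_ -> // _ _ _] := Hact.
- by move=> x q Qq; exact/Q01/actQ.
Qed.

Lemma adapted_transfer n (f : X -> V R) : Qmap Q f ->
  (forall k, measurable_fun [set: g_sigma_algebraType (filt n)]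
     ((fun x => f x k) : g_sigma_algebraType (filt n) -> R)) ->
  forall k, measurable_fun [set: g_sigma_algebraType (filt n.+1)]
     ((fun x => transfer f x k) : g_sigma_algebraType (filt n.+1) -> R).
Proof.
move=> Qf mf k _ B mB; rewrite setTI.
apply/(sub_sigmaP (filt_sigma_algebra n.+1)).
suff : filt n (T @^-1` ((fun x => transfer f x k) @^-1` B)) by [].
pose Y := g_sigma_algebraType (filt n).
have Qf' : Qmap Q (f : Y -> V R) by split; [exact: Qf.1|].
have mw : borel_meas (w : Y -> G).
  by move=> U oU; apply/(sub_sigmaP (filt_sigma_algebra n))/w_filt.
have [_ /(_ k)/(_ measurableT _ mB)] := Qmap_act mw Qf'.
rewrite setTI => /(sub_sigmaP (filt_sigma_algebra n)); congr filt.
by apply/seteqP; split => x; rewrite /= /transfer TK.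
Qed.

Lemma back_term_iter psi x n : Qmap Q psi ->
  back_term mul one Tinv w act pp psi x n = iter n transfer (psi \o pp) x.
Proof.
move=> Qpsi; rewrite /back_term.
have : Qmap Q (psi \o pp) by exact: Qmap_comp.
rewrite -[psi (pp _)]/((psi \o pp) (iter n Tinv x)).
move: (psi \o pp) => f {Qpsi psi}.
have [_ _ a1 aM _] := Hact.
elim: n f => [|n IH] f Qf /=; first by rewrite a1//; exact: Qf.1.
have -> : transfer (iter n transfer f) = iter n transfer (transfer f).
  by rewrite -iterSr.
rewrite -IH; last exact: Qmap_transfer.
by rewrite aM//; exact: Qf.1.
Qed.

(** * The almost everywhere limit of the backward products *)

Section limit.
Variables (psi : Xp -> V R) (Qpsi : Qmap Q psi).

Let M n := iter n transfer (psi \o pp).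

Hypothesis stat : forall k, same_integrals m (filt 0)
  (fun x => M 1 x k) (fun x => M 0 x k).

Let QM n : Qmap Q (M n).
Proof. by apply: Qmap_iter; exact: Qmap_comp. Qed.

Let M_adapted n : forall k, measurable_fun [set: g_sigma_algebraType (filt n)]
     ((fun x => M n x k) : g_sigma_algebraType (filt n) -> R).
Proof.
elim: n => [|n IH]; last exact: (adapted_transfer (QM n) IH).
move=> k _ B mB; rewrite setTI; apply/(sub_sigmaP (filt_sigma_algebra 0)).
have := @pp_filt ((fun y => psi y k) @^-1` B); apply.
by rewrite -[X in measurable X]setTI; exact: Qpsi.2.
Qed.

Let M_mart n : forall k, same_integrals m (filt n)
  (fun x => M n.+1 x k) (fun x => M n x k).
Proof.
elim: n => [//|n IH]; exact: (same_integrals_transfer (QM n.+1) (QM n) IH).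
Qed.

Lemma iter_integrals n j k : (n <= j)%N -> same_integrals m (filt n)
  (fun x => M j x k) (fun x => M n x k).
Proof.
apply: (martingale_le filt_mono (M := fun n x => M n x k)) => i.
exact: M_mart.
Qed.

Lemma limit_exists : exists phi, [/\ Mapw m T w Q act phi,
  {ae m, forall x, (fun n => M n x) @ \oo --> phi x} &
  forall n k, same_integrals m (filt n) (fun x => phi x k) (fun x => M n x k)].
Proof.
have [[q0 Qq0] _ _ Qcl] := HQ.
have /ae_foralln[N [mN N0 HN]] : forall k,
    {ae m, forall x, cvgn (fun n => M n x k)}.
  move=> k; apply: (@martingale_cvg _ _ _ m filt (fun n x => M n x k)).
  - exact: filt_sigma_algebra.
  - exact: filt_measurable.
  - exact: filt_mono.
  - by move=> n x; exact/Q01/(QM n).1.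
  - by move=> n; exact: M_adapted.
  - by move=> n; exact: M_mart.
have cvN x : ~ N x -> forall k, cvgn (fun n => M n x k).
  by move=> nN; apply: contrapT => /HN.
(* On the null set where some coordinate may diverge, the constant [q0] keeps [phi] in [Q]
   everywhere. *)
pose phi x : V R := if x \in N then q0 else fun k => limn (fun n => M n x k : R).
have Mphi x : ~ N x -> (fun n => M n x) @ \oo --> phi x.
  move=> nN; apply: cvg_ptws_seq => k; rewrite /phi memNset//.
  exact: cvN.
have Mphik x k : ~ N x -> (fun n => M n x k : R) @ \oo --> (phi x k : R).
  by move=> nN; rewrite /phi memNset//; exact: cvN.
have phiQ x : Q (phi x).
  have [Nx|nN] := pselect (N x); first by rewrite /phi mem_set.
  by apply: (closed_cvg_seq Qcl _ (Mphi x nN)) => n; exact: (QM n).1.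
have mphi k : measurable_fun [set: X] (fun x => phi x k).
  (* Patched on [N], the approximations converge to [phi] at every point, as [measurable_fun_cvg]
     requires. *)
  pose h n x := M n x k * \1_(~` N) x + q0 k * \1_N x.
  apply: (@measurable_fun_cvg _ _ _ _ h).
    move=> n; apply: measurable_funD.
      apply: measurable_funM; first exact: (QM n).2.
      by apply: measurable_indic; exact: measurableC.
    by apply: measurable_funM => //; exact: measurable_indic.
  move=> x _; have [Nx|nN] := pselect (N x); last first.
    have -> : h ^~ x = fun n => M n x k.
      apply/funext => n; rewrite /h !indicE in_setC memNset//=.
      by rewrite mulr1 mulr0 addr0.
    exact: Mphik.
  have -> : h ^~ x = fun n => q0 k.
    apply/funext => n; rewrite /h !indicE in_setC mem_set//=.
    by rewrite mulr1 mulr0 add0r.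
  by rewrite /phi mem_set//; exact: cvg_cst.
have Qphi : Qmap Q phi by split.
have aeN : {ae m, forall x, ~ N x}.
  by exists N; split => // x /= /contrapT.
have aephi : {ae m, forall x, (fun n => M n x) @ \oo --> phi x}.
  by apply: filterS aeN.
exists phi; split => //.
- split => //.
  (* Where both [x] and [T x] avoid [N], the relation [E] passes to the limit by continuity of the
     action on [Q]. *)
  have := ae_preimage mT Tm aeN; move: aeN; apply: filterS2 => x nNx nNTx.
  apply/funext => k.
  have E n : M n.+1 (T x) = act (w x) (M n x) by rewrite /M iterS /transfer TK.
  have := Mphik _ k nNTx; rewrite -cvg_shiftS.
  under eq_fun do rewrite E.
  move=> c1; apply: (cvg_unique _ c1) => //.
  have sc := slice_continuous (@act_coord_continuous k) (g0 := w x).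
  exact: (cvg_slice sc (fun n => (QM n).1 x) (phiQ x) (Mphi _ nNx)).
- move=> n k A FA; have mA := filt_measurable FA.
  have c1 : \int[m]_(x in A) M j x k @[j --> \oo] --> \int[m]_(x in A) phi x k.
    apply: cvg_Rintegral01 => //.
    + by move=> j; exact: (QM j).2.
    + by move=> j x; exact/Q01/(QM j).1.
    + by apply: filterS aeN => x nN; exact: Mphik.
  apply: (cvg_unique _ c1) => //; apply: cvg_near_cst.
  by exists n => // j /= nj; exact: iter_integrals FA.
Qed.

End limit.

Lemma Mapw_transfer phi : Mapw m T w Q act phi ->
  {ae m, forall x, phi x = transfer phi x}.
Proof.
move=> [Qphi /(ae_preimage mTinv Tinvm)]; apply: filterS => x.
by rewrite TinvK.
Qed.

(** The increasing union of the [filt n] is a pi-system whose sigma-algebra contains all sets of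
    [wsets], hence every measurable set up to a null set. *)
Lemma generating_ae_eq (Hgen : generating m T Tinv w) f h : Qmap Q f -> Qmap Q h ->
  (forall n k, same_integrals m (filt n) (fun x => f x k) (fun x => h x k)) ->
  {ae m, forall x, f x = h x}.
Proof.
move=> Qf Qh fh.
suff : {ae m, forall x k, f x k = h x k}.
  by apply: filterS => x E; apply/funext.
apply: ae_foralln => k.
apply: same_integrals_ae => //; [exact: Qf.2|exact: Qh.2| | |].
- by move=> x; exact/Q01/Qf.1.
- by move=> x; exact/Q01/Qh.1.
pose S : set (set X) := \bigcup_n filt n.
have SI : setI_closed S.
  move=> A B [i _ FA] [j _ FB]; exists (maxn i j) => //.
  have Fa := filt_sigma_algebra (maxn i j).
  apply/(sub_sigmaP Fa)/measurableI; apply/(sub_sigmaP Fa).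
  + exact: filt_le (leq_maxl i j) _ FA.
  + exact: filt_le (leq_maxr i j) _ FB.
have ST : S setT by exists 0%N => //; apply/(sub_sigmaP (filt_sigma_algebra 0)).
have Sm : S `<=` measurable by move=> A [n _ /filt_measurable].
have fhS : same_integrals m S (fun x => f x k) (fun x => h x k).
  by move=> A [n _ FA]; exact: fh FA.
have fhs : same_integrals m <<s S >> (fun x => f x k) (fun x => h x k).
  apply: same_integrals_sigma => //; [exact: Qf.2|exact: Qh.2| |].
  - by move=> x; exact/Q01/Qf.1.
  - by move=> x; exact/Q01/Qh.1.
move=> A mA; have [B sB AB] := Hgen _ mA.
have mB := gen_measurable sB.
rewrite (Rintegral_eqmod0 mA mB AB (bnd Qf k)).
rewrite (Rintegral_eqmod0 mA mB AB (bnd Qh k)).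
apply: fhs; move: B sB {AB mB}; apply: smallest_sub.
  exact: smallest_sigma_algebra.
move=> _ [n [U [oU [->|[_ ->]]]]]; apply: sub_sigma_algebra.
- exists 0%N => //; apply: future_algebra_gen; apply: sub_sigma_algebra.
  by exists n, U; split => //; left.
- exists n => //; have := w_filt 0 oU; rewrite /filt/=; congr future_algebra.
  by apply/seteqP; split => x; rewrite /= iterK.
Qed.

End greg.

(** * Convergence in measure *)

Section convergence_in_measure.
Context (R : realType) d (X : measurableType d) (m : probability X R)
  d' (Xp : measurableType d') (pp : X -> Xp) (mu : R.-pker Xp ~> X)
  (mpp : measurable_fun [set: X] pp) (Hmu : disintegration m pp mu)
  (Q : set (V R)) (HQ : metrizable_ccs Q).

Let Q01 q : Q q -> forall k, 0 <= q k <= 1. Proof. by case: HQ => _ + _ _; exact. Qed.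

Let dist_ge0 (p q : V R) k : (0 <= (2 ^- k * `|p k - q k|)%:E :> \bar R)%E.
Proof. by rewrite lee_fin mulr_ge0// invr_ge0 exprn_ge0. Qed.

Let dQ_ge0 (p q : V R) : (0 <= dQ p q)%E.
Proof. by apply: nneseries_ge0 => k _ _; exact: dist_ge0. Qed.

Let dQ_le2 p q : Q p -> Q q -> (dQ p q <= 2%:E)%E.
Proof.
move=> Qp Qq; apply: lime_le; first by apply: is_cvg_nneseries => k _ _; exact: dist_ge0.
apply: nearW => n; rewrite big_mkord sumEFin lee_fin.
have H : \sum_(k < n) (2 : R) ^- k = 2 - 2 * 2 ^- n.
  elim: n => [|n IH]; first by rewrite big_ord0 expr0 invr1 mulr1 subrr.
  by rewrite big_ord_recr/= IH exprS invfM; field; rewrite expf_neq0.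
apply: (@le_trans _ _ (\sum_(k < n) (2 : R) ^- k)).
  apply: ler_sum => k _; rewrite ler_piMr ?invr_ge0 ?exprn_ge0//.
  have /andP[? ?] := Q01 Qp k; have /andP[? ?] := Q01 Qq k.
  by rewrite ler_norml; apply/andP; split; lra.
by rewrite H gerBl mulr_ge0// invr_ge0 exprn_ge0.
Qed.

Let meas_term d1 (Y : measurableType d1) (f h : Y -> V R) k : Qmap Q f -> Qmap Q h ->
  bounded_meas (fun x => 2 ^- k * `|f x k - h x k|).
Proof.
move=> Qf Qh; apply: bounded_measZ.
have [mfh [c Hc]] :=
  bounded_measB (Qmap_bounded_meas HQ Qf k) (Qmap_bounded_meas HQ Qh k).
by split; [exact: measurableT_comp|exists c => x; rewrite normr_id].
Qed.

Lemma measurable_dQ d1 (Y : measurableType d1) (f h : Y -> V R) :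
  Qmap Q f -> Qmap Q h -> measurable_fun [set: Y] (fun x => dQ (f x) (h x)).
Proof.
move=> Qf Qh; apply: ge0_emeasurable_sum => [k x _ _|k _]; first exact: dist_ge0.
exact/measurable_EFinP/(meas_term k Qf Qh).1.
Qed.

(** Each coordinate of the difference is at most the integral of its absolute value; the weighted
    sum is then exchanged with the integral. *)
Lemma dQ_Fplus (f h : X -> V R) y : Qmap Q f -> Qmap Q h ->
  (dQ (Fplus mu f y) (Fplus mu h y) <= \int[mu y]_x dQ (f x) (h x))%E.
Proof.
move=> Qf Qh.
have muoo : (mu y [set: X] < +oo)%E by rewrite prob_kernel ltry.
have bf := Qmap_bounded_meas HQ Qf; have bh := Qmap_bounded_meas HQ Qh.
have int u : bounded_meas u -> (mu y).-integrable setT (EFin \o u).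
  exact: bounded_meas_integrable.
rewrite /dQ integral_nneseries//; last first.
  by move=> k; exact/measurable_EFinP/(meas_term k Qf Qh).1.
apply: lee_nneseries => [k _ _|k _]; first exact: dist_ge0.
have bt := meas_term k Qf Qh.
rewrite -[leRHS]fineK; last exact: integrable_fin_num (int _ bt).
rewrite lee_fin -/(Rintegral _ _ _).
have bfh := bounded_measB (bf k) (bh k).
rewrite -/(Rintegral (mu y) setT (fun x => 2 ^- k * `|f x k - h x k|)).
rewrite RintegralZl//; last by apply: integrable_norm; exact: int.
rewrite ler_wpM2l// ?invr_ge0 ?exprn_ge0//.
have -> : Fplus mu f y k - Fplus mu h y k = \int[mu y]_x (f x k - h x k).
  by rewrite RintegralB//; exact: int.
by apply: le_normr_Rintegral => //; exact: int.
Qed.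

Lemma integral_dQ_Fplus (f h : X -> V R) : Qmap Q f -> Qmap Q h ->
  (\int[m]_x dQ (Fplus mu f (pp x)) (Fplus mu h (pp x)) <=
   \int[m]_x dQ (f x) (h x))%E.
Proof.
move=> Qf Qh; have mD := measurable_dQ Qf Qh.
have -> : (\int[m]_x dQ (f x) (h x) =
    \int[m]_x \int[mu (pp x)]_z dQ (f z) (h z))%E.
  by have := ge0_integral_disint mpp Hmu measurableT (fun x => dQ_ge0 (f x) (h x)) mD;
    rewrite preimage_setT.
have QF := Qmap_Fplus mu HQ Qf; have QH := Qmap_Fplus mu HQ Qh.
apply: ge0_le_integral => //.
- exact: (measurable_dQ (Qmap_comp mpp QF) (Qmap_comp mpp QH)).
- apply: (@measurableT_comp _ _ _ _ _ _ (fun y => \int[mu y]_z dQ (f z) (h z))%E) => //.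
  by apply: measurable_fun_integral_kernel => //; exact: measurable_mu.
- by move=> x _; exact: dQ_Fplus.
Qed.

(** The integrand is below [e] off the exceptional set and at most 2, the sum of the weights 2^(-k),
    on it. *)
Lemma integral_dQ_le (f h : X -> V R) (e : R) : 0 < e -> Qmap Q f -> Qmap Q h ->
  (\int[m]_x dQ (f x) (h x) <=
   e%:E + 2%:E * m [set x | (e%:E <= dQ (f x) (h x))%E])%E.
Proof.
move=> e0 Qf Qh; have mD := measurable_dQ Qf Qh.
set A := [set x | _].
have mA : measurable A.
  by rewrite -[A]setTI; exact: emeasurable_fun_c_infty.
have -> : (2%:E * m A = \int[m]_x (2%:E * (\1_A x)%:E))%E.
  rewrite ge0_integralZl//; last exact/measurable_EFinP/measurable_indic.
  by rewrite integral_indic// setIT.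
have -> : (e%:E = \int[m]_(x in setT) e%:E)%E.
  rewrite integral_cst// -[LHS]mule1; congr (_ * _)%E.
  by apply/esym; exact: probability_setT.
have mi : measurable_fun [set: X] (fun x => (2 : R)%:E * (\1_A x)%:E)%E.
  apply: emeasurable_funM; first exact: measurable_cst.
  exact/measurable_EFinP/measurable_indic.
rewrite -ge0_integralD//; last by move=> x _; rewrite lee_fin ltW.
apply: ge0_le_integral => //.
- exact: emeasurable_funD.
- move=> x _; rewrite indicE; have [Ax|nA] := pselect (A x).
    rewrite mem_set// mule1; apply: le_trans (dQ_le2 (Qf.1 x) (Qh.1 x)) _.
    by rewrite leeDr// lee_fin ltW.
  rewrite memNset// mule0 adde0 ltW// ltNge; exact/negP.
Qed.

Lemma cvg_in_measure_Fplus (fs : nat -> X -> V R) (f : X -> V R) :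
  (forall n, Qmap Q (fs n)) -> Qmap Q f -> cvg_in_measure m fs f ->
  cvg_in_measure (mplus m pp) (fun n => Fplus mu (fs n)) (Fplus mu f).
Proof.
move=> Qfs Qf cv e e0.
have mE n : measurable [set x |
    (e%:E <= dQ (Fplus mu (fs n) (pp x)) (Fplus mu f (pp x)))%E].
  rewrite -[X in measurable X]setTI; apply: emeasurable_fun_c_infty => //.
  exact: (measurable_dQ (Qmap_comp mpp (Qmap_Fplus mu HQ (Qfs n)))
    (Qmap_comp mpp (Qmap_Fplus mu HQ Qf))).
have mD n (r : R) : measurable [set x | (r%:E <= dQ (fs n x) (f x))%E].
  rewrite -[X in measurable X]setTI; apply: emeasurable_fun_c_infty => //.
  exact: measurable_dQ.
have markov n : (e%:E * mplus m pp [set y | e%:E <= dQ (Fplus mu (fs n) y) (Fplus mu f y)]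
    <= \int[m]_x dQ (fs n x) (f x))%E.
  apply: le_trans (integral_dQ_Fplus (Qfs n) Qf).
  rewrite -[X in (e%:E * X)%E]/(m [set x |
    (e%:E <= dQ (Fplus mu (fs n) (pp x)) (Fplus mu f (pp x)))%E]).
  have mF := measurable_dQ (Qmap_comp mpp (Qmap_Fplus mu HQ (Qfs n)))
    (Qmap_comp mpp (Qmap_Fplus mu HQ Qf)).
  have := @le_integral_comp_abse _ _ _ m _ measurableT _ e id
    (@measurable_id _ _ _) (fun r hr => hr) (fun r s _ _ rs => rs) mF e0.
  rewrite setTI; congr (_ <= _)%E; last first.
    by apply: eq_integral => x _; rewrite gee0_abs.
  by congr (_ * m _)%E; apply/seteqP; split => x /=; rewrite gee0_abs.
apply/fine_cvgP; split.
  by apply: nearW => n; exact: (fin_num_measure m _ (mE n)).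
apply/cvgrPdist_le => r r0.
(* With threshold [e * r / 2] and exceptional mass at most [e * r / 4], the integral is at most
   [e * r]; Markov's inequality at level [e] then leaves [r]. *)
have er0 : 0 < e * r / 2 by rewrite divr_gt0// mulr_gt0.
have /fine_cvgP[_ /cvgrPdist_le/(_ (e * r / 4))] := cv _ er0.
rewrite divr_gt0 ?mulr_gt0// => /(_ isT); apply: filterS => n.
rewrite /= !sub0r !normrN => H.
have := le_trans (markov n) (integral_dQ_le er0 (Qfs n) Qf).
rewrite -[X in (e%:E * X)%E]fineK; last exact: (fin_num_measure m _ (mE n)).
rewrite -[X in (2%:E * X)%E]fineK; last exact: (fin_num_measure m _ (mD n _)).
rewrite -!EFinM -EFinD lee_fin => H2.
rewrite ger0_norm ?fine_ge0//; last exact: (measure_ge0 m).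
move: H; rewrite ger0_norm ?fine_ge0// => H.
rewrite -(ler_pM2l e0); apply: le_trans H2 _; lra.
Qed.

End convergence_in_measure.

Lemma Fplus_cvx (R : realType) d (X : measurableType d) d'
    (Xp : measurableType d') (mu : R.-pker Xp ~> X) (Q : set (V R))
    (f h : X -> V R) (t : R) (y : Xp) :
  metrizable_ccs Q -> Qmap Q f -> Qmap Q h ->
  Fplus mu (fun x => cvx t (f x) (h x)) y = cvx t (Fplus mu f y) (Fplus mu h y).
Proof.
move=> HQ Qf Qh; apply/funext => k.
have muoo : (mu y [set: X] < +oo)%E by rewrite prob_kernel ltry.
have bf := Qmap_bounded_meas HQ Qf k; have bh := Qmap_bounded_meas HQ Qh k.
have int u : bounded_meas u -> (mu y).-integrable setT (EFin \o u).
  exact: bounded_meas_integrable.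
rewrite -[LHS]/(\int[mu y]_x (t * f x k + (1 - t) * h x k)).
by rewrite RintegralD ?RintegralZl//; apply: int => //; exact: bounded_measZ.
Qed.

Theorem theorem3p6
  (R : realType)
  (d : measure_display) (X : measurableType d) (m : probability X R)
  (T Tinv : X -> X) (HT : inv_mp m T Tinv)
  (G : topologicalType) (mul : G -> G -> G) (inv : G -> G) (one : G)
  (HG : lcsc_group mul inv one)
  (w : X -> G) (Hw : borel_meas w) (Hgen : generating m T Tinv w)
  (Q : set (V R)) (HQ : metrizable_ccs Q)
  (act : G -> V R -> V R) (Hact : cont_aff_action mul one Q act)
  (d' : measure_display) (Xp : measurableType d') (pp : X -> Xp)
  (Hpp : future_factor m T Tinv w pp)
  (mu : R.-pker Xp ~> X) (Hmu : disintegration m pp mu) :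
  (* phi |-> psi maps Map_w(X,Q) into Map^stat(X_+,Q), and the inverse
     direction is the a.e. weak-* limit *)
  (forall phi, Mapw m T w Q act phi ->
     [/\ Qmap Q (Fplus mu phi),
         stationary m Tinv w act pp mu (Fplus mu phi) &
         {ae m, forall x,
            back_term mul one Tinv w act pp (Fplus mu phi) x @ \oo --> phi x}])
  (* every stationary psi arises, from the phi given by the limit *)
  /\ (forall psi, Qmap Q psi -> stationary m Tinv w act pp mu psi ->
       exists phi, [/\ Mapw m T w Q act phi,
         {ae m, forall x, back_term mul one Tinv w act pp psi x @ \oo --> phi x} &
         {ae mplus m pp, forall y, Fplus mu phi y = psi y}])
  (* affine *)
  /\ (forall t phi1 phi2, 0 <= t <= 1 ->
       Mapw m T w Q act phi1 -> Mapw m T w Q act phi2 ->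
       {ae mplus m pp, forall y,
          Fplus mu (fun x => cvx t (phi1 x) (phi2 x)) y
          = cvx t (Fplus mu phi1 y) (Fplus mu phi2 y)})
  (* continuous for the topologies of convergence in measure *)
  /\ (forall (phis : nat -> X -> V R) phi,
       (forall n, Mapw m T w Q act (phis n)) -> Mapw m T w Q act phi ->
       cvg_in_measure m phis phi ->
       cvg_in_measure (mplus m pp) (fun n => Fplus mu (phis n)) (Fplus mu phi)).
Proof.
have mpp : measurable_fun [set: X] pp by case: Hpp.
have Qpp psi : Qmap Q psi -> Qmap Q (psi \o pp) by exact: Qmap_comp.
pose F := filt m T Tinv w.
pose L := transfer Tinv w act.
have QL f : Qmap Q f -> Qmap Q (L f) by exact: (Qmap_transfer HT HG Hw Hact).
have aeP f psi (Qf : Qmap Q f) (Qp : Qmap Q psi) :=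
  ae_FplusP HT HQ Hpp Hmu Qf Qp.
have back psi x n : Qmap Q psi -> back_term mul one Tinv w act pp psi x n =
    iter n L (psi \o pp) x.
  exact: (back_term_iter HT HG Hw Hact Hpp).
have back_cvg psi phi : Qmap Q psi ->
    {ae m, forall x, (fun n => iter n L (psi \o pp) x) @ \oo --> phi x} ->
    {ae m, forall x, back_term mul one Tinv w act pp psi x @ \oo --> phi x}.
  move=> Qpsi; apply: filterS => x.
  by have -> : back_term mul one Tinv w act pp psi x =
      (fun n => iter n L (psi \o pp) x) by apply/funext => n; exact: back.
split; [|split; [|split]].
- move=> phi Mphi; have Qphi := Mphi.1.
  have Qpsi := Qmap_Fplus mu HQ Qphi; set psi := Fplus mu phi in Qpsi *.
  (* [phi] equals [L phi] almost everywhere, so transferring the identity from [F n] to [F n.+1]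
     leaves [phi] on the left. *)
  have ce n k : same_integrals m (F n) (fun x => phi x k)
      (fun x => iter n L (psi \o pp) x k).
    elim: n k => [|n IH] k.
      apply: (aeP _ _ Qphi Qpsi).1; rewrite /psi.
      exists set0; split => //; first by rewrite /mplus /pushforward preimage_set0 measure0.
      by move=> y /=; case.
    have QM : Qmap Q (iter n L (psi \o pp)).
      exact: (Qmap_iter HT HG Hw Hact n (Qpp _ Qpsi)).
    move=> A FA; have mA := filt_measurable HT FA.
    rewrite iterS -(same_integrals_transfer HT HG Hw HQ Hact Qphi QM IH k FA).
    apply: Rintegral_ae => //.
    + exact: (Qmap_bounded_meas HQ Qphi).
    + exact: (Qmap_bounded_meas HQ (QL _ Qphi)).
    + by apply: filterS (Mapw_transfer HT Mphi) => x {1}->.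
  (* Over sets of [F 0], which are also in [F 1], both sides integrate as [phi] does. *)
  have st k : same_integrals m (F 0%N) (fun x => iter 1 L (psi \o pp) x k)
      (fun x => iter 0 L (psi \o pp) x k).
    move=> A FA; rewrite -[RHS](ce 0%N k A FA) -(ce 1%N k A)//.
    exact: (filt_mono HT FA).
  have [phi' [Mphi' cvM ceM]] := limit_exists HT HG Hw HQ Hact Hpp Qpsi st.
  split => //; first exact: ((aeP _ _ (QL _ (Qpp _ Qpsi)) Qpsi).2 st).
  apply: back_cvg => //.
  (* The limit [phi'] and the given [phi] integrate alike over every [F n]; the generating
     hypothesis identifies them. *)
  have E : {ae m, forall x, phi' x = phi x}.
    apply: (generating_ae_eq HT Hw HQ Hgen Mphi'.1 Qphi) => n k A FA.
    by rewrite (ceM n k A FA) (ce n k A FA).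
  by move: cvM E; apply: filterS2 => x cx <-.
- move=> psi Qpsi Hst.
  have st := (aeP _ _ (QL _ (Qpp _ Qpsi)) Qpsi).1 Hst.
  have [phi [Mphi cvM ceM]] := limit_exists HT HG Hw HQ Hact Hpp Qpsi st.
  exists phi; split => //; first exact: back_cvg.
  (* At level 0 the integrals of [phi] are those of [psi \o pp], which means that [psi] is the fibre
     average of [phi]. *)
  have := (aeP _ _ Mphi.1 Qpsi).2 (ceM 0%N).
  by move=> [N [mN N0 HN]]; exists N; split => // y /= ny; apply: HN => /= E; exact: ny.
- move=> t phi1 phi2 _ [Q1 _] [Q2 _]; exists set0; split => //.
    by rewrite /mplus /pushforward preimage_set0 measure0.
  by move=> y /=; case; exact: (Fplus_cvx _ _ _ HQ Q1 Q2).
- move=> phis phi Mphis [Qphi _]; apply: (cvg_in_measure_Fplus mpp Hmu HQ) => //.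
  by move=> n; have [] := Mphis n.
Qed.
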